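(* Let $(E,D)=(B_p,\ell_p)$ for some $1<p<\infty$ or $(E,D)=(S_p,c_0)$ for some $1\le p<\infty$. A basic sequence in $E$ is subsymmetric if and only if it is equivalent to the unit vector basis for $D$.
   Context: $\mathbb{K}$ denotes the scalar field, either $\mathbb{R}$ or $\mathbb{C}$, and $\mathbb{N}=\{1,2,3,\ldots\}$. Sequences are written as functions: $x(n)$ is the $n$-th coordinate of $x\in\mathbb{K}^{\mathbb{N}}$. The unit vector basis $(e_n)_{n\in\mathbb{N}}$ is given by $e_n(m)=1$ if $m=n$ and $e_n(m)=0$ otherwise. A Schreier set is a finite set $F\subset\mathbb{N}$ such that $F=\emptyset$ or $|F|\le\min F$; $\mathcal{S}_1$ denotes the family of all Schreier sets. For non-empty finite sets $F,G\subset\mathbb{N}$, $F<G$ means $\max F<\min G$. $p$-convexified Schreier space $S_p$ ($1\le p<\infty$): for $x\in\mathbb{K}^{\mathbb{N}}$ and $F\in\mathcal{S}_1$ set $\mu_p(x,F)=\bigl(\sum_{n\in F}|x(n)|^p\bigr)^{1/p}$ (equal to $0$ if $F=\emptyset$) and $\|x\|_{S_p}=\sup\{\mu_p(x,F):F\in\mathcal{S}_1\}$. Let $Z_p=\{x\in\mathbb{K}^{\mathbb{N}}:\|x\|_{S_p}<\infty\}$, a Banach space under $\|\cdot\|_{S_p}$; $S_p$ is the closed linear span of $\{e_n:n\in\mathbb{N}\}$ in $Z_p$. Baernstein space $B_p$ ($1<p<\infty$): a Schreier chain is a non-empty finite collection $\mathcal{C}=\{F_1<F_2<\cdots<F_m\}$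 of non-empty Schreier sets. Set $\beta_p(x,\mathcal{C})=\bigl(\sum_{F\in\mathcal{C}}\bigl(\sum_{n\in F}|x(n)|\bigr)^p\bigr)^{1/p}$ and $\|x\|_{B_p}=\sup\{\beta_p(x,\mathcal{C}):\mathcal{C}\text{ a Schreier chain}\}$. Then $B_p=\{x\in\mathbb{K}^{\mathbb{N}}:\|x\|_{B_p}<\infty\}$, a Banach space under $\|\cdot\|_{B_p}$. A basic sequence $(x_n)$ dominates a basic sequence $(y_n)$ (possibly in another Banach space) if there is $C>0$ such that $\|\sum_{n=1}^k\alpha_ny_n\|\le C\|\sum_{n=1}^k\alpha_nx_n\|$ for all $k\in\mathbb{N}$ and $\alpha_1,\ldots,\alpha_k\in\mathbb{K}$; the two are equivalent if each dominates the other. A basis for a Banach space is subsymmetric if it is unconditional and equivalent to all its subsequences; a basic sequence is subsymmetric if it is a subsymmetric basis for its closed linear span. *)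

(* Defs.v *)
From HB Require Import structures.
From mathcomp Require Import all_boot all_order all_algebra finmap complex.
From mathcomp Require Import all_classical all_reals all_analysis.

Set Implicit Arguments.
Unset Strict Implicit.
Unset Printing Implicit Defensive.

Import Order.TTheory GRing.Theory Num.Theory.
Import numFieldNormedType.Exports.

Local Open Scope classical_set_scope.
Local Open Scope ring_scope.

Section basic_sequences.
Context {K : numFieldType} {V : normedModType K}.
Implicit Types u : nat -> V.

Definition lin_span u : set V :=
  [set y | exists (n : nat) (a : nat -> K), y = \sum_(i < n) a i *: u i].

Definition closed_span u : set V := closure (lin_span u).

Definition basic_sequence u : Prop :=
  forall y, closed_span u y ->
    exists! a : nat -> K, series (fun n => a n *: u n) @ \oo --> y.

Definition unconditional u : Prop :=
  forall a : nat -> K, cvgn (series (fun n => a n *: u n)) ->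
    forall s : nat -> nat, bijective s ->
      cvgn (series (fun n => a (s n) *: u (s n))).

End basic_sequences.

Section domination.
Context {K : numFieldType} {V W : normedModType K}.

(* [C] lives in [K] because norms do; [0 < C] forces it to be real. *)
Definition dominates (u : nat -> V) (v : nat -> W) : Prop :=
  exists2 C : K, 0 < C &
    forall (n : nat) (a : nat -> K),
      `|\sum_(i < n) a i *: v i| <= C * `|\sum_(i < n) a i *: u i|.

End domination.

Definition equivalent {K : numFieldType} {V W : normedModType K}
    (u : nat -> V) (v : nat -> W) : Prop :=
  dominates u v /\ dominates v u.

(* That [u] is a basic sequence is a separate hypothesis. *)
Definition subsymmetric {K : numFieldType} {V : normedModType K}
    (u : nat -> V) : Prop :=
  unconditional u /\
  forall k : nat -> nat, {homo k : i j / (i < j)%N} -> equivalent u (u \o k).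

Variant scalars := RealScalars | ComplexScalars.

Definition scalar_field (R : realType) (k : scalars) : numFieldType :=
  match k with RealScalars => R | ComplexScalars => R[i] end.

Section scalars.
Context {R : realType} {k : scalars}.
Local Notation K := (scalar_field R k).

Definition modulus : K -> R :=
  match k return scalar_field R k -> R with
  | RealScalars => fun x => `|x|
  | ComplexScalars => fun z => Num.sqrt (complex.Re z ^+ 2 + complex.Im z ^+ 2)
  end.

Definition of_real : R -> K :=
  match k return R -> scalar_field R k with
  | RealScalars => id
  | ComplexScalars => real_complex R
  end.

End scalars.
Arguments of_real {R} k.

Section scalars_theory.
Context {R : realType}.
Implicit Types k : scalars.

Lemma norm_modulus k (z : scalar_field R k) : `|z| = of_real k (modulus z).
Proof. by case: k z => //= z; rewrite normc_def. Qed.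

Lemma le_of_real k (x y : R) : (of_real k x <= of_real k y) = (x <= y).
Proof. by case: k => //=; rewrite lecE/= eqxx. Qed.

Lemma of_realD k (x y : R) : of_real k (x + y) = of_real k x + of_real k y.
Proof. by case: k => //=; rewrite rmorphD. Qed.

Lemma of_realM k (x y : R) : of_real k (x * y) = of_real k x * of_real k y.
Proof. by case: k => //=; rewrite rmorphM. Qed.

Lemma of_real0 k : of_real k (0 : R) = 0.
Proof. by case: k. Qed.

Lemma of_real1 k : of_real k (1 : R) = 1.
Proof. by case: k. Qed.

Lemma of_real_inj k : injective (of_real k : R -> _).
Proof. by case: k => //= x y []. Qed.

Lemma modulus_ge0 k (z : scalar_field R k) : 0 <= modulus z.
Proof. by rewrite -(le_of_real k) of_real0 -norm_modulus. Qed.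

Lemma modulus0 k : modulus (0 : scalar_field R k) = 0.
Proof. by apply: (@of_real_inj k); rewrite -norm_modulus of_real0 normr0. Qed.

Lemma modulus1 k : modulus (1 : scalar_field R k) = 1.
Proof. by apply: (@of_real_inj k); rewrite -norm_modulus of_real1 normr1. Qed.

Lemma modulus0_eq0 k (z : scalar_field R k) : modulus z = 0 -> z = 0.
Proof. by move=> z0; apply/normr0_eq0; rewrite norm_modulus z0 of_real0. Qed.

Lemma modulusM k (y z : scalar_field R k) :
  modulus (y * z) = modulus y * modulus z.
Proof.
by apply: (@of_real_inj k); rewrite of_realM -!norm_modulus normrM.
Qed.

Lemma modulusD k (y z : scalar_field R k) :
  modulus (y + z) <= modulus y + modulus z.
Proof. by rewrite -(le_of_real k) of_realD -!norm_modulus ler_normD. Qed.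

End scalars_theory.

(* The coordinate of index [i] stands for the [i.+1]-th coordinate of a
   sequence indexed by the positive integers. *)
Definition delta {K : numFieldType} (n : nat) : nat -> K :=
  fun m => (m == n)%:R.

Record extended_norm (R : realType) (k : scalars) := ExtendedNorm {
  enorm :> (nat -> scalar_field R k) -> \bar R;
  enorm_ge0 : forall x, (0 <= enorm x)%E;
  enormD : forall x y, (enorm (x + y)%R <= enorm x + enorm y)%E;
  enormZ : forall a x, enorm (a *: x) = ((modulus a)%:E * enorm x)%E;
  enorm_eq0 : forall x, enorm x = 0%E -> x = 0;
  enorm_delta : forall n, (enorm (delta n) < +oo)%E }.

Section finite_space.
Context {R : realType} {k : scalars} (N : extended_norm R k).
Local Notation K := (scalar_field R k).

Definition finite_enorm : {pred nat -> K} := fun x => (N x < +oo)%E.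

Record finite_space :=
  FiniteSpace { coords :> nat -> K; _ : coords \in finite_enorm }.

HB.instance Definition _ := [isSub for coords].
HB.instance Definition _ := [Choice of finite_space by <:].

Lemma finite_enorm_submod_closed : submod_closed finite_enorm.
Proof.
split=> [|a x y]; rewrite !unfold_in.
  by rewrite -(scale0r (0 : nat -> K)) enormZ modulus0 mul0e.
move=> xoo yoo; apply: le_lt_trans (enormD _ _ _) _.
rewrite lte_add_pinfty// enormZ lte_mul_pinfty// lee_fin//.
exact: modulus_ge0.
Qed.

HB.instance Definition _ := GRing.isSubmodClosed.Build _ _ finite_enorm
  finite_enorm_submod_closed.
HB.instance Definition _ := [SubChoice_isSubLmodule of finite_space by <:].

Lemma coordsD (x y : finite_space) : coords (x + y) = coords x + coords y.
Proof. exact: (raddfD (val : finite_space -> _)). Qed.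

Lemma coordsZ (a : K) (x : finite_space) : coords (a *: x) = a *: coords x.
Proof. exact: (linearZ_LR (val : finite_space -> _)). Qed.

Definition finite_space_norm (x : finite_space) : K :=
  of_real k (fine (N x)).

Lemma enorm_fineK (x : finite_space) : ((fine (N x))%:E = N x)%E.
Proof.
rewrite fineK// fin_numElt (lt_le_trans ltNy0) ?enorm_ge0//=.
exact: (valP x).
Qed.

Lemma finite_space_normD (x y : finite_space) :
  finite_space_norm (x + y) <= finite_space_norm x + finite_space_norm y.
Proof.
rewrite -of_realD le_of_real -lee_fin EFinD !enorm_fineK.
exact: enormD.
Qed.

Lemma finite_space_normZ (a : K) (x : finite_space) :
  finite_space_norm (a *: x) = `|a| * finite_space_norm x.
Proof.
rewrite norm_modulus -of_realM; congr of_real; apply: EFin_inj.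
by rewrite EFinM enorm_fineK coordsZ enormZ enorm_fineK.
Qed.

Lemma finite_space_norm_eq0 (x : finite_space) :
  finite_space_norm x = 0 -> x = 0.
Proof.
rewrite -(of_real0 k) => /of_real_inj x0; apply/val_inj/(@enorm_eq0 _ _ N).
by rewrite -[LHS]enorm_fineK x0.
Qed.

HB.instance Definition _ := Lmodule_isNormed.Build K finite_space
  finite_space_normD finite_space_normZ finite_space_norm_eq0.

Lemma norm_finite_spaceE (x : finite_space) : `|x| = of_real k (fine (N x)).
Proof. by []. Qed.

Definition unit_vector (n : nat) : finite_space :=
  FiniteSpace (enorm_delta N n : delta n \in finite_enorm).

End finite_space.

Section subspace.
Context {K : numFieldType} {V : normedModType K} (A : submodClosed V).

Record normed_subspace := NormedSubspace { inclusion :> V; _ : inclusion \in A }.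

HB.instance Definition _ := [isSub for inclusion].
HB.instance Definition _ := [Choice of normed_subspace by <:].
HB.instance Definition _ := [SubChoice_isSubLmodule of normed_subspace by <:].

Definition normed_subspace_norm (x : normed_subspace) : K := `|inclusion x|.

Lemma normed_subspace_normD (x y : normed_subspace) :
  normed_subspace_norm (x + y)
    <= normed_subspace_norm x + normed_subspace_norm y.
Proof. exact: ler_normD. Qed.

Lemma normed_subspace_normZ (a : K) (x : normed_subspace) :
  normed_subspace_norm (a *: x) = `|a| * normed_subspace_norm x.
Proof. exact: normrZ. Qed.

Lemma normed_subspace_norm_eq0 (x : normed_subspace) :
  normed_subspace_norm x = 0 -> x = 0.
Proof. by move=> /normr0_eq0 x0; exact: val_inj. Qed.

HB.instance Definition _ := Lmodule_isNormed.Build K normed_subspace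
  normed_subspace_normD normed_subspace_normZ normed_subspace_norm_eq0.

Lemma inclusionD (x y : normed_subspace) :
  inclusion (x + y) = inclusion x + inclusion y.
Proof. exact: (raddfD (val : normed_subspace -> _)). Qed.

Lemma inclusionZ (a : K) (x : normed_subspace) :
  inclusion (a *: x) = a *: inclusion x.
Proof. exact: (linearZ_LR (val : normed_subspace -> _)). Qed.

Lemma norm_inclusion (x : normed_subspace) : `|inclusion x| = `|x|.
Proof. by []. Qed.

End subspace.

Section closed_span_pred.
Context {K : numFieldType} {V : normedModType K} (u : nat -> V).

Definition in_closed_span : {pred V} := fun y => `[< closed_span u y >].

Lemma in_closed_span_submod_closed : submod_closed in_closed_span.
Proof.
have H y : closed_span u y <->
    forall e : K, 0 < e -> exists2 z, lin_span u z & `|y - z| < e.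
  split=> [cy e e0|cy B].
    have [z [uz yz]] := cy _ (nbhsx_ballx y e e0).
    by exists z => //; move: yz; rewrite -ball_normE.
  move=> /nbhs_ballP[e /= e0 yeB]; have [z uz yz] := cy _ e0.
  by exists z; split=> //; apply: yeB; rewrite -ball_normE.
have S (n m : nat) (a : nat -> K) : (n <= m)%N ->
    \sum_(i < n) a i *: u i
    = \sum_(i < m) (if (i < n)%N then a i else 0) *: u i.
  move=> nm; rewrite (big_ord_widen m (fun i => a i *: u i) nm) big_mkcond/=.
  by apply: eq_bigr => i _; case: ifPn => // _; rewrite scale0r.
split=> [|a x y]; rewrite !unfold_in.
  apply/asboolP/subset_closure.
  by exists 0%N, (fun=> 0); rewrite big_ord0.
move=> /asboolP/H cx /asboolP/H cy; apply/asboolP/H => e e0.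
have d0 : 0 < `|a| + 1 by rewrite ltr_wpDl.
have [x' [n [b ->]] xx'] := cx (e / 2 / (`|a| + 1)) ltac:(by rewrite !divr_gt0).
have [y' [m [c ->]] yy'] := cy (e / 2) ltac:(by rewrite divr_gt0).
rewrite (S _ _ b (leq_maxl n m)) in xx'; rewrite (S _ _ c (leq_maxr n m)) in yy'.
set b' := (fun i => if (i < n)%N then b i else 0) in xx'.
set c' := (fun i => if (i < m)%N then c i else 0) in yy'.
exists (\sum_(i < maxn n m) (a * b' i + c' i) *: u i).
  by exists (maxn n m), (fun i => a * b' i + c' i).
under eq_bigr do rewrite scalerDl -scalerA.
rewrite big_split/= -scaler_sumr opprD addrACA -scalerBr.
rewrite (le_lt_trans (ler_normD _ _))// normrZ [ltRHS]splitr ler_ltD//.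
rewrite (le_trans (ler_wpM2l _ (ltW xx')))//.
rewrite mulrCA -[leRHS]mulr1 ler_wpM2l ?divr_ge0 ?ltW//.
by rewrite ltr_pdivrMr// mul1r ltrDl.
Qed.

HB.instance Definition _ := GRing.isSubmodClosed.Build _ _ in_closed_span
  in_closed_span_submod_closed.

End closed_span_pred.

Section minkowski.
Context {R : realType}.

Lemma Lnorm_seq (I : Type) (i0 : I) (r : seq I) (a : I -> R) (p : R) :
  1 <= p -> (forall i, 0 <= a i) ->
  ('N[counting]_p%:E[EFin \o (fun n => if (n < size r)%N then a (nth i0 r n)
                                    else 0%R)]
   = ((\sum_(i <- r) a i `^ p) `^ p^-1)%R%:E)%E.
Proof.
move=> p1 a0; have p0 : 0 < p by exact: lt_le_trans p1.
rewrite Lnorm_counting//.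
rewrite (nneseries_split 0 (size r))/=; last by move=> n _; rewrite lee_fin powR_ge0.
rewrite [X in (_ + X)%E]eseries0 ?adde0; last first.
  move=> n /=; rewrite add0n => rn _; rewrite ltnNge rn/=.
  by rewrite normr0 powR0// gt_eqF.
rewrite add0n -poweR_EFin -sumEFin; congr (_ `^ _)%E.
rewrite (big_nth i0) big_nat [RHS]big_nat; apply: eq_bigr => n /= rn.
by rewrite rn ger0_norm.
Qed.

Lemma minkowski_seq (I : Type) (r : seq I) (a b : I -> R) (p : R) :
  1 <= p -> (forall i, 0 <= a i) -> (forall i, 0 <= b i) ->
  (\sum_(i <- r) (a i + b i) `^ p) `^ p^-1
  <= (\sum_(i <- r) a i `^ p) `^ p^-1 + (\sum_(i <- r) b i `^ p) `^ p^-1.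
Proof.
case: r => [|i0 r] p1 a0 b0.
  by rewrite !big_nil lerDl powR_ge0.
have ab0 i : 0 <= a i + b i by exact: addr_ge0.
pose t (c : I -> R) n : R :=
  if (n < size (i0 :: r))%N then c (nth i0 (i0 :: r) n) else 0.
have mt c : measurable_fun [set: nat] (t c) by [].
have H := eminkowski counting (mt a) (mt b) (p1 : (1 <= p%:E)%E).
have tD : EFin \o (t a \+ t b) = EFin \o t (fun i => a i + b i).
  by apply/funext => n; rewrite /t /=; case: ifPn => //; rewrite addr0.
rewrite tD /t (Lnorm_seq _ _ p1 a0) (Lnorm_seq _ _ p1 b0) in H.
by rewrite (Lnorm_seq _ _ p1 ab0) in H.
Qed.

Lemma powRK (c p : R) : 0 <= c -> p != 0 -> (c `^ p) `^ p^-1 = c.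
Proof. by move=> c0 p0; rewrite -powRrM mulfV// powRr1. Qed.

Lemma sum_powR_ge0 (I : Type) (r : seq I) (a : I -> R) (p : R) :
  0 <= \sum_(i <- r) a i `^ p.
Proof. by apply: sumr_ge0 => i _; exact: powR_ge0. Qed.

Lemma le_minkowski_seq (I : Type) (r : seq I) (a b c : I -> R) (p : R) :
    1 <= p -> (forall i, 0 <= a i) -> (forall i, 0 <= b i) ->
    (forall i, 0 <= c i) -> (forall i, c i <= a i + b i) ->
  (\sum_(i <- r) c i `^ p) `^ p^-1
  <= (\sum_(i <- r) a i `^ p) `^ p^-1 + (\sum_(i <- r) b i `^ p) `^ p^-1.
Proof.
move=> p1 a0 b0 c0 cab; have p0 : 0 <= p by exact: le_trans ler01 p1.
apply: le_trans (minkowski_seq r p1 a0 b0).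
apply: ge0_ler_powR.
- by rewrite invr_ge0.
- by rewrite nnegrE sum_powR_ge0.
- by rewrite nnegrE sum_powR_ge0.
apply: ler_sum => i _; apply: ge0_ler_powR => //.
- by rewrite nnegrE.
- by rewrite nnegrE addr_ge0.
Qed.

Lemma sum_powRZ (I : Type) (r : seq I) (a : I -> R) (c p : R) :
    p != 0 -> 0 <= c -> (forall i, 0 <= a i) ->
  (\sum_(i <- r) (c * a i) `^ p) `^ p^-1
  = c * (\sum_(i <- r) a i `^ p) `^ p^-1.
Proof.
move=> p0 c0 a0; under eq_bigr do rewrite powRM//.
by rewrite -mulr_sumr powRM ?powR_ge0 ?sum_powR_ge0// powRK.
Qed.

Lemma sum_powR_le1 (I : Type) (r : seq I) (a : I -> bool) (p : R) :
    0 < p -> \sum_(i <- r) (a i)%:R <= 1 :> R ->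
  (\sum_(i <- r) (a i)%:R `^ p) `^ p^-1 <= 1 :> R.
Proof.
move=> p0 ar; rewrite [leRHS](_ : 1 = 1 `^ p^-1); last by rewrite powR1.
apply: ge0_ler_powR.
- by rewrite invr_ge0 ltW.
- by rewrite nnegrE sum_powR_ge0.
- by rewrite nnegrE.
apply: le_trans ar; apply: ler_sum => i _.
by case: (a i); rewrite ?powR1 // powR0 // gt_eqF.
Qed.

End minkowski.

Lemma modulus_delta {R : realType} {k : scalars} n m :
  modulus (delta n m : scalar_field R k) = (m == n)%:R.
Proof. by rewrite /delta; case: eqP => _; rewrite ?modulus1 ?modulus0. Qed.

Lemma sum_delta {R : realType} n (F : {fset nat}) :
  \sum_(m <- F) (m == n)%:R = (n \in F)%:R :> R.
Proof.
rewrite -natr_sum; congr (_ %:R).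
transitivity (\sum_(m <- F | m == n) 1)%N.
  by rewrite [RHS]big_mkcond/=; apply: eq_bigr => m _; case: eqP.
by rewrite sum1_count count_uniq_mem.
Qed.

Section sup_norm_family.
Context {R : realType} {k : scalars} {T : Type} (A : set T).
Local Notation K := (scalar_field R k).
Variable f : (nat -> K) -> T -> R.
Hypothesis A0 : A !=set0.
Hypothesis f_ge0 : forall x t, 0 <= f x t.
Let N x : \bar R := ereal_sup [set (f x t)%:E | t in A].

Lemma sup_family_le x t : A t -> ((f x t)%:E <= N x)%E.
Proof. by move=> At; apply: ereal_sup_ubound; exists t. Qed.

Lemma sup_family_ge0 x : (0 <= N x)%E.
Proof.
by case: A0 => t At; apply: le_trans (sup_family_le x At); rewrite lee_fin.
Qed.

Lemma sup_familyD (fD : forall x y t, f (x + y) t <= f x t + f y t) x y :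
  (N (x + y)%R <= N x + N y)%E.
Proof.
apply: ge_ereal_sup => _ [t At <-].
apply: (@le_trans _ _ ((f x t)%:E + (f y t)%:E)%E).
  by rewrite -EFinD lee_fin fD.
by rewrite leeD// sup_family_le.
Qed.

Lemma sup_familyZ (fZ : forall a x t, f (a *: x) t = modulus a * f x t) a x :
  N (a *: x) = ((modulus a)%:E * N x)%E.
Proof.
rewrite /N -ereal_supZl ?modulus_ge0//; last first.
  by apply/set0P; case: A0 => t At; exists (f x t)%:E, t.
rewrite image_comp; congr ereal_sup; apply: eq_imagel => t At /=.
by rewrite fZ ?EFinM.
Qed.

Lemma sup_family_eq0 x t : A t -> N x = 0%E -> f x t = 0.
Proof.
move=> At x0; apply/eqP; rewrite eq_le f_ge0 andbT -lee_fin -[leRHS]x0.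
exact: sup_family_le.
Qed.

Lemma sup_family_lty (c : R) x : (forall t, A t -> f x t <= c) -> (N x < +oo)%E.
Proof.
move=> fc; apply: (@le_lt_trans _ _ c%:E); last exact: ltry.
by apply: ge_ereal_sup => _ [t At <-]; rewrite lee_fin fc.
Qed.

End sup_norm_family.

(* With the index shift, [i \in F] stands for [i.+1], hence the condition
   reads [#|F| <= min F]. *)
Definition schreier (F : {fset nat}) : bool :=
  all (fun i => #|` F| <= i.+1)%N F.

Lemma schreier1 n : schreier [fset n]%fset.
Proof. by apply/allP => i _; rewrite cardfs1. Qed.

Section schreier_space.
Context {R : realType} (k : scalars).
Local Notation K := (scalar_field R k).
Implicit Types (x y : nat -> K) (F : {fset nat}).

Definition schreier_mu (p : R) x F : R :=
  (\sum_(n <- F) modulus (x n) `^ p) `^ p^-1.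

Definition schreier_norm (p : R) x : \bar R :=
  ereal_sup [set (schreier_mu p x F)%:E | F in [set F | schreier F]].

Variables (p : R) (p1 : 1 <= p).

Let p0 : 0 < p. Proof. exact: lt_le_trans ltr01 p1. Qed.
Let pN0 : p != 0. Proof. by rewrite gt_eqF. Qed.

Let nonempty : [set F | schreier F] !=set0.
Proof. by exists fset0. Qed.

Let mu_ge0 x F : 0 <= schreier_mu p x F.
Proof. exact: powR_ge0. Qed.

Lemma schreier_muD x y F :
  schreier_mu p (x + y) F <= schreier_mu p x F + schreier_mu p y F.
Proof. by apply: le_minkowski_seq => // n; rewrite ?modulus_ge0 ?modulusD. Qed.

Lemma schreier_muZ (a : K) x F :
  schreier_mu p (a *: x) F = modulus a * schreier_mu p x F.
Proof.
rewrite /schreier_mu; under eq_bigr do rewrite modulusM.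
exact: sum_powRZ pN0 (modulus_ge0 a) (fun n => modulus_ge0 (x n)).
Qed.

Lemma schreier_norm_eq0 x : schreier_norm p x = 0%E -> x = 0.
Proof.
move=> x0; apply/funext => n; apply: modulus0_eq0.
have := sup_family_eq0 mu_ge0 (schreier1 n) x0.
by rewrite /schreier_mu big_seq_fset1 powRK// modulus_ge0.
Qed.

Lemma schreier_norm_delta n : (schreier_norm p (delta n) < +oo)%E.
Proof.
apply: (@sup_family_lty _ _ _ _ _ 1) => F _; rewrite /schreier_mu.
under eq_bigr do rewrite modulus_delta.
by apply: sum_powR_le1 => //; rewrite sum_delta; case: (_ \in _).
Qed.

Definition schreier_enorm : extended_norm R k :=
  @ExtendedNorm R k (schreier_norm p)
    (sup_family_ge0 nonempty mu_ge0)
    (@sup_familyD _ _ _ _ _ schreier_muD)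
    (sup_familyZ nonempty schreier_muZ)
    schreier_norm_eq0 schreier_norm_delta.

Definition schreier_Z : normedModType K := finite_space schreier_enorm.

Definition schreier_space : normedModType K :=
  normed_subspace
    (in_closed_span (unit_vector schreier_enorm : nat -> schreier_Z)).

End schreier_space.

(* The list is written in the order $F_1 < \cdots < F_m$. *)
Definition schreier_chain (C : seq {fset nat}) : bool :=
  [&& C != [::], all (fun F => (F != fset0) && schreier F) C
    & pairwise (fun F G : {fset nat} => allrel ltn F G) C].

Lemma schreier_chain1 n : schreier_chain [:: [fset n]%fset].
Proof.
rewrite /schreier_chain/= schreier1 !andbT.
by apply/fset0Pn; exists n; rewrite in_fset1.
Qed.

Section baernstein_space.
Context {R : realType} (k : scalars).
Local Notation K := (scalar_field R k).
Implicit Types (x y : nat -> K) (C : seq {fset nat}).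

Definition baernstein_beta (p : R) x C : R :=
  (\sum_(F <- C) (\sum_(n <- F) modulus (x n)) `^ p) `^ p^-1.

Definition baernstein_norm (p : R) x : \bar R :=
  ereal_sup [set (baernstein_beta p x C)%:E | C in [set C | schreier_chain C]].

Variables (p : R) (p1 : 1 < p).

Let p0 : 0 < p. Proof. exact: lt_trans ltr01 p1. Qed.
Let pN0 : p != 0. Proof. by rewrite gt_eqF. Qed.

Let nonempty : [set C | schreier_chain C] !=set0.
Proof. by exists [:: [fset 0%N]%fset]; exact: schreier_chain1. Qed.

Let beta_ge0 x C : 0 <= baernstein_beta p x C.
Proof. exact: powR_ge0. Qed.

Let sum_modulus_ge0 x (F : {fset nat}) : 0 <= \sum_(n <- F) modulus (x n).
Proof. by apply: sumr_ge0 => n _; exact: modulus_ge0. Qed.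

Lemma baernstein_betaD x y C :
  baernstein_beta p (x + y) C <= baernstein_beta p x C + baernstein_beta p y C.
Proof.
apply: le_minkowski_seq => //; first exact: ltW.
by move=> F; rewrite -big_split/=; apply: ler_sum => n _; exact: modulusD.
Qed.

Lemma baernstein_betaZ (a : K) x C :
  baernstein_beta p (a *: x) C = modulus a * baernstein_beta p x C.
Proof.
rewrite /baernstein_beta.
have sumE (F : {fset nat}) : \sum_(n <- F) modulus ((a *: x) n)
    = modulus a * \sum_(n <- F) modulus (x n).
  by rewrite mulr_sumr; apply: eq_bigr => n _; rewrite modulusM.
under eq_bigr do rewrite sumE.
exact: sum_powRZ pN0 (modulus_ge0 a) (sum_modulus_ge0 x).
Qed.

Lemma baernstein_norm_eq0 x : baernstein_norm p x = 0%E -> x = 0.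
Proof.
move=> x0; apply/funext => n; apply: modulus0_eq0.
have := sup_family_eq0 beta_ge0 (schreier_chain1 n) x0.
by rewrite /baernstein_beta big_seq1 big_seq_fset1 powRK// modulus_ge0.
Qed.

Lemma baernstein_norm_delta n : (baernstein_norm p (delta n) < +oo)%E.
Proof.
apply: (@sup_family_lty _ _ _ _ _ 1) => C /and3P[_ _ Clt].
rewrite /baernstein_beta.
have sumE (F : {fset nat}) :
    \sum_(m <- F) modulus (delta n m : K) = (n \in F)%:R.
  by rewrite -sum_delta; apply: eq_bigr => m _; rewrite modulus_delta.
under eq_bigr do rewrite sumE.
apply: sum_powR_le1 => //; elim: C Clt => [_|F C IH /= /andP[FC /IH {}IH]].
  by rewrite big_nil.
rewrite big_cons; case: (boolP (n \in F)) => nF; last by rewrite add0r.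
rewrite big_seq big1 ?addr0// => G GC.
case: (boolP (n \in G)) => // nG.
by have /allrelP/(_ _ _ nF nG) := allP FC _ GC; rewrite /= ltnn.
Qed.

Definition baernstein_enorm : extended_norm R k :=
  @ExtendedNorm R k (baernstein_norm p)
    (sup_family_ge0 nonempty beta_ge0)
    (@sup_familyD _ _ _ _ _ baernstein_betaD)
    (sup_familyZ nonempty baernstein_betaZ)
    baernstein_norm_eq0 baernstein_norm_delta.

Definition baernstein_space : normedModType K := finite_space baernstein_enorm.

End baernstein_space.

Section ell_p.
Context {R : realType} (k : scalars).
Local Notation K := (scalar_field R k).
Implicit Types x y : nat -> K.

Definition lp_norm (p : R) x : \bar R :=
  ((\sum_(0 <= n <oo) (modulus (x n) `^ p)%:E) `^ p^-1)%E.

Variables (p : R) (p1 : 1 <= p).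

Let p0 : 0 < p. Proof. exact: lt_le_trans ltr01 p1. Qed.
Let pN0 : p != 0. Proof. by rewrite gt_eqF. Qed.

Let term_ge0 x n : (0 <= (modulus (x n) `^ p)%:E)%E.
Proof. by rewrite lee_fin powR_ge0. Qed.

Lemma lp_norm_ge0 x : (0 <= lp_norm p x)%E.
Proof. exact: poweR_ge0. Qed.

Lemma lp_normE x : lp_norm p x = ('N[counting]_p%:E[EFin \o (modulus \o x)])%E.
Proof.
rewrite Lnorm_counting// /lp_norm; congr (_ `^ _)%E.
by apply: eq_eseriesr => n _ /=; rewrite ger0_norm ?modulus_ge0.
Qed.

Lemma lp_normD x y : (lp_norm p (x + y)%R <= lp_norm p x + lp_norm p y)%E.
Proof.
have mx (z : nat -> K) : measurable_fun [set: nat] (modulus \o z : nat -> R) by [].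
rewrite !lp_normE.
apply: le_trans (eminkowski counting (mx x) (mx y) (p1 : (1 <= p%:E)%E)).
rewrite !Lnorm_counting//; apply: gt0_ler_poweR.
- by rewrite invr_ge0 ltW.
- by rewrite in_itv/= leey nneseries_ge0// => n _ _; rewrite poweR_ge0.
- by rewrite in_itv/= leey nneseries_ge0// => n _ _; rewrite poweR_ge0.
apply: lee_nneseries => [n _ _|n _]; first by rewrite poweR_ge0.
rewrite /= lee_fin; apply: ge0_ler_powR; rewrite ?nnegrE//; first exact: ltW.
rewrite !ger0_norm ?addr_ge0 ?modulus_ge0//; exact: modulusD.
Qed.

Lemma lp_normZ (a : K) x : lp_norm p (a *: x) = ((modulus a)%:E * lp_norm p x)%E.
Proof.
rewrite /lp_norm.
under eq_eseriesr do rewrite modulusM powRM ?modulus_ge0// EFinM.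
rewrite nneseriesZl// poweRM ?nneseries_ge0//; last first.
  by rewrite lee_fin powR_ge0.
by rewrite poweR_EFin powRK// modulus_ge0.
Qed.

Lemma lp_norm_eq0 x : lp_norm p x = 0%E -> x = 0.
Proof.
move=> /poweR_eq0_eq0 x0; apply/funext => n; apply: modulus0_eq0.
have {}x0 := x0 (nneseries_ge0 (fun n _ _ => term_ge0 x n)).
have := nneseries_lim_ge n.+1 (fun n _ _ => term_ge0 x n) (P := xpredT) (m := 0%N).
rewrite x0 big_nat_recr//= sumEFin -EFinD lee_fin => xn.
apply/eqP; have : modulus (x n) `^ p <= 0.
  by apply: le_trans xn; rewrite lerDr sum_powR_ge0.
by rewrite le_eqVlt ltNge powR_ge0 orbF powR_eq0 pN0 andbT.
Qed.

Lemma lp_norm_delta n : (lp_norm p (delta n) < +oo)%E.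
Proof.
rewrite /lp_norm (nneseries_split 0 n.+1)/=; last by move=> m _; exact: term_ge0.
rewrite [X in (_ + X)%E]eseries0 ?adde0; last first.
  move=> m /= nm _; rewrite modulus_delta gtn_eqF ?powR0//.
by rewrite sumEFin poweR_EFin ltry.
Qed.

Definition lp_enorm : extended_norm R k :=
  @ExtendedNorm R k (lp_norm p) lp_norm_ge0 lp_normD lp_normZ
    lp_norm_eq0 lp_norm_delta.

Definition lp_space : normedModType K := finite_space lp_enorm.

Definition lp_unit_vector : nat -> lp_space := unit_vector lp_enorm.

End ell_p.

Section c_0.
Context (R : realType) (k : scalars).
Local Notation K := (scalar_field R k).
Implicit Types x y : nat -> K.

Definition linfty_norm x : \bar R :=
  ereal_sup [set (modulus (x n))%:E | n in [set: nat]].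

Let term x n := modulus (x n).

Let nonempty : [set: nat] !=set0. Proof. by exists 0%N. Qed.

Let term_ge0 x n : 0 <= term x n. Proof. exact: modulus_ge0. Qed.

Let termD x y n : term (x + y) n <= term x n + term y n.
Proof. exact: modulusD. Qed.

Let termZ (a : K) x n : term (a *: x) n = modulus a * term x n.
Proof. exact: modulusM. Qed.

Lemma linfty_norm_eq0 x : linfty_norm x = 0%E -> x = 0.
Proof.
move=> x0; apply/funext => n; apply: modulus0_eq0.
exact: (sup_family_eq0 term_ge0 (I : [set: nat] n) x0).
Qed.

Lemma linfty_norm_delta n : (linfty_norm (delta n) < +oo)%E.
Proof.
apply: (@sup_family_lty _ _ _ _ term 1) => m _.
by rewrite /term modulus_delta; case: eqP.
Qed.

Definition linfty_enorm : extended_norm R k :=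
  @ExtendedNorm R k linfty_norm
    (sup_family_ge0 nonempty term_ge0) (@sup_familyD _ _ _ _ _ termD)
    (sup_familyZ nonempty termZ) linfty_norm_eq0 linfty_norm_delta.

Definition linfty_space : normedModType K := finite_space linfty_enorm.

Definition null_sequence : {pred linfty_space} :=
  fun z => `[< coords (z : finite_space linfty_enorm) @ \oo --> (0 : K) >].

Lemma null_sequence_submod_closed : submod_closed null_sequence.
Proof.
split=> [|a x y]; rewrite !unfold_in.
  by apply/asboolP; exact: cvg_cst.
move=> /asboolP x0 /asboolP y0; apply/asboolP.
rewrite -[X in _ --> X]addr0 -[X in _ --> X + _](mulr0 a).
have ax0 : (fun n => a * coords x n) @ \oo --> a * 0 by exact: cvgMr.
exact: cvgD ax0 y0.
Qed.

HB.instance Definition _ := GRing.isSubmodClosed.Build _ _ null_sequence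
  null_sequence_submod_closed.

Definition c0_space : normedModType K := normed_subspace null_sequence.

Lemma null_sequence_unit_vector n :
  unit_vector linfty_enorm n \in null_sequence.
Proof.
rewrite unfold_in; apply/asboolP; apply: cvg_near_cst.
by exists n.+1 => // m /= nm; apply/eqP; rewrite /delta gtn_eqF.
Qed.

Definition c0_unit_vector (n : nat) : c0_space :=
  NormedSubspace (null_sequence_unit_vector n).

End c_0.

(* Main.v *)
Require Import Defs.
From mathcomp Require Import all_boot all_order all_algebra finmap complex.
From mathcomp Require Import all_classical all_reals all_analysis.
From mathcomp Require Import ring lra zify.

Set Implicit Arguments.
Unset Strict Implicit.
Unset Printing Implicit Defensive.

Import Order.TTheory GRing.Theory Num.Theory.
Import numFieldNormedType.Exports.
Local Open Scope classical_set_scope.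
Local Open Scope ring_scope.

(** Both spaces are lattices of scalar sequences in which a norm of l_q type on
Schreier sets ([q = 1] for the Baernstein space, [q = p] for the Schreier space)
is combined along successive sets by an l_p norm or by a supremum. Write D for
l_p, respectively c_0. Two facts drive the proof. Successive blocks bounded below
in norm always dominate the basis of D. Successive bounded blocks are dominated
by it as soon as their coordinates decrease fast enough, because a Schreier set
that starts before a block has too few elements to see more than a tiny part of
that block. By a gliding hump, and after passing to a subsequence, the first fact
extends to coordinatewise null sequences bounded below in norm
([coord_null_lower]), and the second one to bounded sequences whose coordinates
tend to 0 uniformly ([sup_null_upper]).

Let u be a subsymmetric sequence. Being equivalent to its subsequences, it is
bounded and bounded away from 0, and one may assume that it converges
coordinatewise to some z.

Suppose that z = 0. The sequence then dominates the basis of D. If no subsequence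
had coordinates tending to 0 uniformly, then combinations supported on sets of
indices that are small compared with their minimum would dominate those of l_q; but
normalised averages of more and more terms have uniformly small coordinates, so
a subsequence of them is dominated by the basis of D, whose sums grow more slowly
than those of l_q. This contradiction ([large_coord_null_false]) shows that the
coordinates do tend to 0 uniformly along a subsequence, so that u is dominated by
the basis of D.

Suppose that z is arbitrary. The differences of consecutive terms are covered by
the preceding domination ([coord_null_upper]). For coefficients which are null in
D but sum up to 1 over each dyadic interval, the series of differences converges.
Unconditionality allows one to sum the terms with positive sign first within each
dyadic interval, and the resulting averages of terms of u tend to 0 as well as,
coordinatewise, to z. Hence z = 0 ([unconditional_spreading_limit]).

Conversely the basis of D is unconditional and spreading, and both properties
pass to equivalent sequences ([equivalent_basis_subsymmetric]). Convergence of
series is handled through the Cauchy condition, and completeness of both spaces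
([cauchy_series_limit]) links it to convergence. *)

(** * Scalars *)

Section scalar_complements.
Context {R : realType} {k : scalars}.
Local Notation K := (scalar_field R k).
Implicit Types (y z : K) (r : R).

Lemma modulus_of_real r : modulus (of_real k r) = `|r|.
Proof.
apply: (@of_real_inj R k); rewrite -norm_modulus.
case: k => //=; rewrite normc_def /= expr0n addr0 sqrtr_sqr; reflexivity.
Qed.

Lemma modulusN z : modulus (- z) = modulus z.
Proof. by apply: (@of_real_inj R k); rewrite -!norm_modulus normrN. Qed.

Lemma modulusB y z : modulus (y - z) <= modulus y + modulus z.
Proof. by rewrite -[modulus z]modulusN; exact: modulusD. Qed.

Lemma modulus_sum (I : Type) (r : seq I) (P : pred I) (f : I -> K) :
  modulus (\sum_(i <- r | P i) f i) <= \sum_(i <- r | P i) modulus (f i).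
Proof.
elim/big_rec2 : _ => [|i y z _ H]; first by rewrite modulus0.
by apply: le_trans (modulusD _ _) _; rewrite lerD2l.
Qed.

(** Real and imaginary parts that make sense for both scalar fields: compactness
of bounded sets of scalars is reduced through them to that of real segments. *)
Definition re_part : K -> R :=
  match k return scalar_field R k -> R with
  | RealScalars => fun x => x
  | ComplexScalars => fun w => complex.Re w
  end.

Definition im_part : K -> R :=
  match k return scalar_field R k -> R with
  | RealScalars => fun=> 0
  | ComplexScalars => fun w => complex.Im w
  end.

Definition of_parts : R -> R -> K :=
  match k return R -> R -> scalar_field R k with
  | RealScalars => fun x _ => x
  | ComplexScalars => fun a b : R => complex.Complex a b
  end.

Lemma re_part_le z : `|re_part z| <= modulus z.
Proof.
rewrite /re_part /modulus; case: k z => //= z.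
by rewrite -sqrtr_sqr ler_wsqrtr// lerDl sqr_ge0.
Qed.

Lemma im_part_le z : `|im_part z| <= modulus z.
Proof.
rewrite /im_part /modulus; case: k z => //= z; first by rewrite normr0.
by rewrite -sqrtr_sqr ler_wsqrtr// lerDr sqr_ge0.
Qed.

Lemma modulus_parts z (x y : R) :
  modulus (z - of_parts x y) <= `|re_part z - x| + `|im_part z - y|.
Proof.
rewrite /re_part /im_part /of_parts /modulus.
case: k z => /= z; first by rewrite lerDl.
case: z => a b /=.
rewrite -[leRHS]ger0_norm ?addr_ge0// -sqrtr_sqr ler_wsqrtr//.
have sq (t : R) : t ^+ 2 = `|t| ^+ 2 by rewrite real_normK ?num_real.
rewrite [leRHS]sqrrD [X in X + _ <= _]sq [X in _ + X <= _]sq.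
by rewrite lerD2r lerDl mulrn_wge0// mulr_ge0.
Qed.

End scalar_complements.

(** * Upper bounds for norms of scalar sequences *)

Section norm_bounds.
Context {R : realType} {k : scalars}.
Local Notation K := (scalar_field R k).
Implicit Types (N : extended_norm R k) (x y a : nat -> K) (c d : R).

(** Norms take values in the extended reals and may be infinite. All estimates
are phrased through real upper bounds, so that infinite values never enter the
arithmetic; a lower bound for a norm is phrased as the transfer of an upper
bound, or as the failure of one. *)
Definition norm_le N x c : Prop := (N x <= c%:E)%E.

Lemma norm_le_ge0 N x c : norm_le N x c -> 0 <= c.
Proof. by move=> xc; rewrite -lee_fin; apply: le_trans xc; exact: enorm_ge0. Qed.

Lemma norm_leW N x c d : c <= d -> norm_le N x c -> norm_le N x d.
Proof. by move=> cd /le_trans; apply; rewrite lee_fin. Qed.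

Lemma norm_leD N x y c d :
  norm_le N x c -> norm_le N y d -> norm_le N (x + y) (c + d).
Proof.
by move=> xc yd; apply: le_trans (enormD _ _ _) _; rewrite EFinD leeD.
Qed.

Lemma norm_leZ N (z : K) x c :
  norm_le N x c -> norm_le N (z *: x) (modulus z * c).
Proof.
by move=> xc; rewrite /norm_le enormZ EFinM lee_wpmul2l// lee_fin modulus_ge0.
Qed.

Lemma norm_leZr N r x c :
  0 <= r -> norm_le N x c -> norm_le N (of_real k r *: x) (r * c).
Proof. by move=> r0 /(norm_leZ (of_real k r)); rewrite modulus_of_real ger0_norm. Qed.

Lemma norm_leN N x c : norm_le N x c -> norm_le N (- x) c.
Proof.
move=> /(norm_leZ (- 1)); rewrite modulusN modulus1 mul1r.
by rewrite scaleN1r.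
Qed.

Lemma norm_leB N x y c d :
  norm_le N x c -> norm_le N y d -> norm_le N (x - y) (c + d).
Proof. by move=> xc /norm_leN yd; exact: norm_leD. Qed.

Lemma norm_le0 N : norm_le N 0 0.
Proof. by rewrite /norm_le -(scale0r (0 : nat -> K)) enormZ modulus0 mul0e. Qed.

Lemma norm_le_sum N (I : eqType) (r : seq I) (P : pred I)
    (f : I -> nat -> K) (c : I -> R) :
  (forall i, i \in r -> P i -> norm_le N (f i) (c i)) ->
  norm_le N (\sum_(i <- r | P i) f i) (\sum_(i <- r | P i) c i).
Proof.
move=> H; rewrite big_seq_cond [X in norm_le _ _ X]big_seq_cond.
elim/big_rec2 : _ => [|i d y /andP[ir Pi] yd]; first exact: norm_le0.
by apply: norm_leD => //; exact: H.
Qed.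

Lemma norm_le_gap N x c :
  (forall e, 0 < e -> norm_le N x (c + e)) -> norm_le N x c.
Proof. by move=> H; apply/lee_addgt0Pr => e e0; rewrite -EFinD; exact: H. Qed.

Lemma norm_le_ex N x : (N x < +oo)%E -> exists c, norm_le N x c.
Proof.
move=> xoo; exists (fine (N x)); rewrite /norm_le fineK//.
by rewrite fin_numElt xoo andbT; apply: lt_le_trans (enorm_ge0 N x).
Qed.

Lemma norm_le_lty N x c : norm_le N x c -> (N x < +oo)%E.
Proof. by move=> /le_lt_trans; apply; rewrite ltry. Qed.

Definition crop (P : pred nat) x : nat -> K := fun n => if P n then x n else 0.

Lemma cropD P x y : crop P (x + y) = crop P x + crop P y.
Proof.
apply/funext => n; change (crop P (x + y) n = crop P x n + crop P y n).
by rewrite /crop; case: (P n); rewrite ?addr0.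
Qed.

Lemma cropN P x : crop P (- x) = - crop P x.
Proof.
apply/funext => n; change (crop P (- x) n = - crop P x n).
by rewrite /crop; case: (P n); rewrite ?oppr0.
Qed.

Lemma cropZ P (z : K) x : crop P (z *: x) = z *: crop P x.
Proof.
apply/funext => n; change (crop P (z *: x) n = z * crop P x n).
by rewrite /crop; case: (P n); rewrite ?mulr0.
Qed.

Lemma crop_comp P Q x :
  crop P (crop Q x) = crop (fun n => P n && Q n) x.
Proof. by apply/funext => n; rewrite /crop; case: (P n). Qed.

Lemma cropC P x : x = crop P x + crop (fun n => ~~ P n) x.
Proof.
apply/funext => n.
change (x n = crop P x n + crop (fun n => ~~ P n) x n); rewrite /crop /=.
by case: (P n); rewrite ?addr0 ?add0r.
Qed.

Definition comb a (u : nat -> nat -> K) n : nat -> K := \sum_(i < n) a i *: u i.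

Lemma combE a u n m : comb a u n m = \sum_(i < n) a i * u i m.
Proof. by rewrite /comb fct_sumE. Qed.

Lemma comb_interval a u m n :
  \sum_(m <= i < n) a i *: u i = comb (crop (fun i => m <= i)%N a) u n.
Proof.
rewrite /comb; case: (leqP m n) => mn.
  rewrite -(big_mkord xpredT (fun i => crop _ a i *: u i)).
  rewrite (big_cat_nat (leq0n m) mn) /= [X in _ = X + _]big_nat.
  rewrite [X in _ = X + _]big1 ?add0r.
    apply: eq_big_nat => i /andP[mi _].
    by rewrite /crop mi.
  by move=> i /andP[_ im]; rewrite /crop leqNgt im /= scale0r.
rewrite big_geq ?(ltnW mn)// big1// => i _.
by rewrite /crop leqNgt (ltn_trans _ mn)// scale0r.
Qed.

Lemma combB a u m n : (m <= n)%N ->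
  comb a u n - comb a u m = \sum_(m <= i < n) a i *: u i.
Proof.
move=> mn; rewrite /comb -!(big_mkord xpredT (fun i => a i *: u i)).
by rewrite (big_cat_nat (leq0n m) mn)/= addrAC subrr add0r.
Qed.

Lemma comb_delta a n : comb a delta n = crop (fun i => i < n)%N a.
Proof.
apply/funext => m; rewrite combE /crop /delta.
case: ltnP => mn.
  rewrite (bigD1 (Ordinal mn))//= eqxx mulr1 big1 ?addr0// => i /eqP im.
  by case: eqP => [mi|_]; rewrite ?mulr0//; case: im; exact/val_inj.
rewrite big1// => i _; rewrite gtn_eqF ?mulr0//.
exact: leq_trans (ltn_ord i) mn.
Qed.

Lemma eq_comb a b (u v : nat -> nat -> K) n :
  (forall i, (i < n)%N -> a i *: u i = b i *: v i) -> comb a u n = comb b v n.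
Proof. by move=> H; apply: eq_bigr => i _; exact: H. Qed.

End norm_bounds.

(** * Domination and unconditionality read on coordinates *)

Section coordinate_domination.
Context {R : realType} {k : scalars}.
Local Notation K := (scalar_field R k).
Implicit Types (N : extended_norm R k) (x y a : nat -> K) (c d : R)
  (u v w : nat -> nat -> K).

(** Domination as a transfer of upper bounds, which makes the two norms
interchangeable without knowing that they are finite. *)
Definition coord_dominates N1 u N2 v : Prop :=
  exists2 C : R, 0 < C & forall n a c,
    norm_le N1 (comb a u n) c -> norm_le N2 (comb a v n) (C * c).

Definition coord_equivalent N1 u N2 v : Prop :=
  coord_dominates N1 u N2 v /\ coord_dominates N2 v N1 u.

Lemma coord_dominates_trans N1 u N2 v N3 w :
  coord_dominates N1 u N2 v -> coord_dominates N2 v N3 w ->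
  coord_dominates N1 u N3 w.
Proof.
move=> [C C0 uv] [D D0 vw]; exists (D * C); first exact: mulr_gt0.
by move=> n a c uc; rewrite -mulrA; apply: vw; exact: uv.
Qed.

Lemma coord_equivalent_sym N1 u N2 v :
  coord_equivalent N1 u N2 v -> coord_equivalent N2 v N1 u.
Proof. by case. Qed.

Lemma coord_equivalent_trans N1 u N2 v N3 w :
  coord_equivalent N1 u N2 v -> coord_equivalent N2 v N3 w ->
  coord_equivalent N1 u N3 w.
Proof.
by move=> [uv vu] [vw wv]; split;
  [exact: coord_dominates_trans vw|exact: coord_dominates_trans vu].
Qed.

(** A combination of [u (f 0), u (f 1), ...] is a combination of [u]: the
coefficients of the indices with the same image are added up, so that [f] may be
a subsequence, a permutation, or any map at all. *)
Lemma comb_reindex (f : nat -> nat) a u n :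
  comb a (u \o f) n =
  comb (fun j => \sum_(i < n | f i == j) a i) u (\max_(i < n) f i).+1.
Proof.
rewrite /comb; under [RHS]eq_bigr do rewrite scaler_suml big_mkcond/=.
rewrite exchange_big/=; apply: eq_bigr => i _.
have fi : (f i < (\max_(i < n) f i).+1)%N by rewrite ltnS; exact: leq_bigmax.
rewrite (bigD1 (Ordinal fi))//= eqxx big1 ?addr0// => j /eqP ji.
by case: eqP => // fij; case: ji; exact/val_inj.
Qed.

Lemma coord_dominates_comp N1 u N2 v (f : nat -> nat) :
  coord_dominates N1 u N2 v -> coord_dominates N1 (u \o f) N2 (v \o f).
Proof.
move=> [C C0 uv]; exists C => // n a c.
rewrite (comb_reindex f a u) (comb_reindex f a v); exact: uv.
Qed.

Lemma coord_equivalent_comp N1 u N2 v (f : nat -> nat) :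
  coord_equivalent N1 u N2 v -> coord_equivalent N1 (u \o f) N2 (v \o f).
Proof. by case=> uv vu; split; exact: coord_dominates_comp. Qed.

(** The Cauchy form of convergence of a series: it is transferred by domination,
and no limit has to be exhibited before completeness is established. *)
Definition cauchy_series N a u : Prop :=
  forall e, 0 < e -> exists M : nat, forall m n, (M <= m)%N ->
    norm_le N (\sum_(m <= i < n) a i *: u i) e.

Lemma cauchy_series_dominates N1 u N2 v a :
  coord_dominates N1 u N2 v -> cauchy_series N1 a u -> cauchy_series N2 a v.
Proof.
move=> [C C0 uv] au e e0; have [M auM] := au _ (divr_gt0 e0 C0).
exists M => m n Mm; have := auM m n Mm; rewrite !comb_interval => /uv.
by rewrite mulrC divfK ?gt_eqF.
Qed.

Definition coord_unconditional N u : Prop :=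
  forall a, cauchy_series N a u -> forall s : nat -> nat, bijective s ->
    cauchy_series N (a \o s) (u \o s).

(** Unconditionality passes to an equivalent sequence since a permutation of the
first series is dominated by the same permutation of the second one. *)
Lemma coord_unconditional_equivalent N1 u N2 v :
  coord_equivalent N1 u N2 v -> coord_unconditional N1 u ->
  coord_unconditional N2 v.
Proof.
move=> [uv vu] uu a av s bs.
apply: (cauchy_series_dominates (coord_dominates_comp s uv)).
by apply: uu => //; exact: cauchy_series_dominates av.
Qed.

Definition spreading N u : Prop :=
  forall f : nat -> nat, {homo f : i j / (i < j)%N} ->
    coord_equivalent N u N (u \o f).

Definition coord_subsymmetric N u : Prop := coord_unconditional N u /\ spreading N u.

(** The tails of [x] tend to 0 in norm. These vectors form both the whole
Baernstein space and the closed span of the unit vectors in the Schreier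
case. *)
Definition regular N x : Prop :=
  forall e, 0 < e -> exists m, norm_le N (crop (fun n => m <= n)%N x) e.

End coordinate_domination.
(** * Subsequences and gliding choices *)

Lemma increasing_ge (f : nat -> nat) :
  {homo f : i j / (i < j)%N} -> forall i, (i <= f i)%N.
Proof.
by move=> fi; elim=> // i IH; apply: leq_ltn_trans IH _; apply: fi.
Qed.

Lemma increasing_nondecreasing (f : nat -> nat) :
  {homo f : i j / (i < j)%N} -> {homo f : i j / (i <= j)%N}.
Proof. by move=> fi i j; rewrite leq_eqVlt => /orP[/eqP->//|/fi/ltnW]. Qed.

Lemma increasing_inj (f : nat -> nat) :
  {homo f : i j / (i < j)%N} -> injective f.
Proof.
by move=> fi i j fij; case: (ltngtP i j) => // /fi; rewrite fij ltnn.
Qed.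

Lemma increasing_step (f : nat -> nat) :
  (forall i, (f i < f i.+1)%N) -> {homo f : i j / (i < j)%N}.
Proof. by move=> H; apply: homo_ltn => // y x z; exact: ltn_trans. Qed.

Lemma increasing_comp (f g : nat -> nat) :
  {homo f : i j / (i < j)%N} -> {homo g : i j / (i < j)%N} ->
  {homo f \o g : i j / (i < j)%N}.
Proof. by move=> fi gi i j /gi/fi. Qed.

(** The inductive construction behind every gliding hump below: [s i] separates
what has been chosen from what comes next, and [f i] is the index chosen at
stage [i], whose vector essentially lives between [s i] and [s i.+1]. *)
Lemma gliding_choice (P : nat -> nat -> nat -> nat -> Prop) :
  (forall i s k0, exists k s', [/\ (k0 <= k)%N, (s < s')%N & P i s k s']) ->
  exists f s, [/\ {homo f : i j / (i < j)%N}, {homo s : i j / (i < j)%N}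
    & forall i, P i (s i) (f i) (s i.+1)].
Proof.
move=> H.
have H' (t : nat * nat * nat) : exists ks : nat * nat,
    [/\ (t.2 <= ks.1)%N, (t.1.2 < ks.2)%N & P t.1.1 t.1.2 ks.1 ks.2].
  by have [k [s' ?]] := H t.1.1 t.1.2 t.2; exists (k, s').
have [g gP] := choice H'.
pose st := fix st i : nat * nat := if i is j.+1 then
  let ks := g (j, (st j).2, (st j).1) in (ks.1.+1, ks.2) else (0, 0)%N.
exists (fun i => (g (i, (st i).2, (st i).1)).1), (fun i => (st i).2); split.
- by apply: increasing_step => i; have [/=] := gP (i.+1, (st i.+1).2, (st i.+1).1).
- by apply: increasing_step => i; have [/=] := gP (i, (st i).2, (st i).1).
- by move=> i; have [/=] := gP (i, (st i).2, (st i).1).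
Qed.

Lemma subsequence_choice (P : nat -> nat -> Prop) :
  (forall i k0, exists2 k, (k0 <= k)%N & P i k) ->
  exists2 f, {homo f : i j / (i < j)%N} & forall i, P i (f i).
Proof.
move=> H; have [|f [s [fi _ fP]]] := @gliding_choice (fun i _ k _ => P i k).
  by move=> i s k0; have [k kk0 Pk] := H i k0; exists k, s.+1.
by exists f.
Qed.

Lemma sum_half_le1 (R : realFieldType) n : \sum_(i < n) 2^-1 ^+ i.+1 <= 1 :> R.
Proof.
have -> : \sum_(i < n) 2^-1 ^+ i.+1 = 1 - 2^-1 ^+ n :> R.
  elim: n => [|n IH]; first by rewrite big_ord0 expr0 subrr.
  rewrite big_ord_recr/= IH -addrA; congr (_ + _).
  by rewrite exprS; lra.
by rewrite gerBl exprn_ge0// invr_ge0.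
Qed.

(** * Norms of Schreier type and the gliding hump *)

Section schreier_like_spaces.
Context {R : realType} {k : scalars}.
Local Notation K := (scalar_field R k).
Implicit Types (N D : extended_norm R k) (x y a : nat -> K) (c d : R)
  (u v w : nat -> nat -> K).

Definition blocks (s : nat -> nat) w : Prop :=
  {homo s : i j / (i < j)%N} /\
  forall i n, ~~ (s i <= n < s i.+1)%N -> w i n = 0.

(** The properties of the two norms on which the theorem rests. [N] is the norm
of the space, [D] the norm whose unit vectors are the model basis, and [q] the
exponent of the inner norm carried by a single Schreier set: [q = 1] for the
Baernstein space, [q = p] for the Schreier space.

The decisive fields are [sl_lower] and [sl_upper]: blocks of norm larger than 1
dominate the model basis, and blocks with sufficiently small coordinates are
dominated by it. In [sl_upper] the factor [s i] bounds the cardinality of a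
Schreier set that meets the coordinates below [s i], so such a set sees only a
tiny part of the block [w i]. The fields [sl_schreier], [sl_sum_blocks] and
[sl_basis_growth] say that spread out coordinates behave like the basis of
l_q, and that the model basis is asymptotically smaller than that of l_q. The
field [sl_basis_dyadic] gives coefficients whose sum over each dyadic interval
is 1 although their series converges in the model space. *)
Record schreier_like N D (q : R) : Prop := SchreierLike {
  sl_exponent : 1 <= q;
  sl_lattice : forall x y c, (forall n, modulus (x n) <= modulus (y n)) ->
    norm_le N y c -> norm_le N x c;
  sl_fatou : forall x c,
    (forall m, norm_le N (crop (fun n => n < m)%N x) c) -> norm_le N x c;
  sl_coord : forall x c n, norm_le N x c -> modulus (x n) <= c;
  sl_lower : forall s w a n c, blocks s w ->
    (forall i, ~ norm_le N (w i) 1) ->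
    norm_le N (comb a w n) c -> norm_le D (comb a delta n) c;
  sl_upper : forall s w a n c, blocks s w ->
    (forall i, norm_le N (w i) 1) ->
    (forall i m, (s i)%:R * modulus (w i m) <= 2^-1 ^+ i.+1) ->
    norm_le D (comb a delta n) c -> norm_le N (comb a w n) (2 * c);
  sl_schreier : forall x c (F : {fset nat}), schreier F ->
    norm_le N x c -> schreier_mu q x F <= c;
  sl_sum_blocks : forall s w n, blocks s w ->
    (forall i, norm_le N (w i) 1) ->
    norm_le N (\sum_(i < n) w i) (n%:R `^ q^-1);
  sl_basis_lattice : forall x y c,
    (forall n, modulus (x n) <= modulus (y n)) ->
    norm_le D y c -> norm_le D x c;
  sl_basis_coord : forall x c n, norm_le D x c -> modulus (x n) <= c;
  sl_basis_spreading : spreading D delta;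
  sl_basis_growth : forall e, 0 < e -> exists2 n, (0 < n)%N &
    norm_le D (\sum_(n <= i < n.*2) delta i) (e * n%:R `^ q^-1);
  sl_basis_dyadic :
    cauchy_series D (fun i => of_real k (2^-1 ^+ trunc_log 2 i)) delta }.

Variables (N D : extended_norm R k) (q : R).
Hypothesis NDq : schreier_like N D q.

Lemma norm_le_crop P x c : norm_le N x c -> norm_le N (crop P x) c.
Proof.
move=> xc; apply: (sl_lattice NDq) xc => n; rewrite /crop.
by case: (P n); rewrite ?modulus0 ?modulus_ge0.
Qed.

Lemma norm_le_delta n : exists2 c, 0 < c & norm_le N (delta n) c.
Proof.
have [c dc] := norm_le_ex (enorm_delta N n); exists (c + 1).
  by rewrite ltr_wpDl// (norm_le_ge0 dc).
by apply: norm_leW dc; rewrite lerDl.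
Qed.

Lemma norm_le_head m x : exists c, norm_le N (crop (fun n => n < m)%N x) c.
Proof.
have He n : exists c, norm_le N (delta n) c.
  by have [c _ dc] := norm_le_delta n; exists c.
have [e eP] := choice He.
rewrite -comb_delta; exists (\sum_(i < m) modulus (x i) * e i).
by apply: norm_le_sum => i _ _; exact: norm_leZ.
Qed.

Lemma regular_bounded x : regular N x -> exists c, norm_le N x c.
Proof.
move=> /(_ 1 ltr01)[m xm]; have [c xc] := norm_le_head m x.
exists (c + 1); rewrite [x](cropC (fun n => n < m)%N).
apply: norm_leD => //; rewrite (_ : crop _ x = crop (fun n => m <= n)%N x)//.
by apply/funext => n; rewrite /crop -leqNgt.
Qed.

Lemma regularD x y : regular N x -> regular N y -> regular N (x + y).
Proof.
move=> rx ry e e0; have e2 : 0 < e / 2 by rewrite divr_gt0.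
have [m xm] := rx _ e2; have [p yp] := ry _ e2.
exists (maxn m p); rewrite cropD [e]splitr.
by apply: norm_leD;
  [apply: (sl_lattice NDq) xm|apply: (sl_lattice NDq) yp] => n;
  rewrite /crop geq_max; case: (leqP m n) => _ //=; case: (leqP p n);
  rewrite ?modulus0 ?modulus_ge0.
Qed.

Lemma regularZ (z : K) x : regular N x -> regular N (z *: x).
Proof.
move=> rx e e0; have z1 : 0 < modulus z + 1 by rewrite ltr_wpDl ?modulus_ge0.
have [m xm] := rx _ (divr_gt0 e0 z1); exists m.
rewrite cropZ; apply: norm_leW (norm_leZ z xm).
by rewrite mulrCA -[leRHS]mulr1 ler_wpM2l// ?(ltW e0)// ltW// ltr_pdivrMr// mul1r ltrDl.
Qed.

Lemma regular0 : regular N 0.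
Proof.
move=> e e0; exists 0%N; apply/norm_le_crop; apply: norm_leW (norm_le0 N).
exact: ltW.
Qed.

Lemma regular_sum (I : Type) (r : seq I) (P : pred I) (f : I -> nat -> K) :
  (forall i, regular N (f i)) -> regular N (\sum_(i <- r | P i) f i).
Proof.
move=> H; elim/big_rec : _ => [|i x _ rx]; first exact: regular0.
exact: regularD.
Qed.

Lemma regular_comb a u n : (forall i, regular N (u i)) -> regular N (comb a u n).
Proof. by move=> H; apply: regular_sum => i; exact: regularZ. Qed.

Lemma coord_bounded_comb a n c :
  norm_le D (comb a delta n) c -> forall i, (i < n)%N -> modulus (a i) <= c.
Proof.
move=> ac i lin; have := sl_basis_coord NDq i ac.
by rewrite comb_delta /crop lin.
Qed.

Lemma comb_perturbation v w a n c e (h : nat -> R) :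
  0 <= c -> (forall i, norm_le N (v i - w i) (h i)) ->
  (forall i, (i < n)%N -> modulus (a i) <= c) -> \sum_(i < n) h i <= e ->
  norm_le N (comb a v n - comb a w n) (c * e).
Proof.
move=> c0 vw ac he; rewrite /comb -sumrB.
apply: (norm_leW (c := \sum_(i < n) modulus (a i) * h i)).
  apply: le_trans (_ : c * \sum_(i < n) h i <= _); last by rewrite ler_wpM2l.
  rewrite mulr_sumr; apply: ler_sum => i _; rewrite ler_wpM2r//; last exact: ac.
  exact: norm_le_ge0 (vw i).
by apply: norm_le_sum => i _ _; rewrite -scalerBr; exact: norm_leZ.
Qed.

Definition coord_null u : Prop := forall n e, 0 < e ->
  exists M : nat, forall i, (M <= i)%N -> modulus (u i n) <= e.

Definition sup_null u : Prop := forall e, 0 < e ->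
  exists M : nat, forall i, (M <= i)%N -> forall n, modulus (u i n) <= e.

(** A fixed finite set of coordinates carries little norm, since the norm of the
head is at most a fixed combination of these coordinates. *)
Lemma coord_null_head u s e : coord_null u -> 0 < e ->
  exists M : nat, forall i, (M <= i)%N ->
    norm_le N (crop (fun n => n < s)%N (u i)) e.
Proof.
move=> u0; elim: s e => [|s IH] e e0.
  exists 0%N => i _; apply: (norm_leW (ltW e0)).
  by rewrite -comb_delta /comb big_ord0; exact: norm_le0.
have e2 : 0 < e / 2 by rewrite divr_gt0.
have [M uM] := IH _ e2; have [c c0 dc] := norm_le_delta s.
have [P uP] := u0 s _ (divr_gt0 e2 c0); exists (maxn M P) => i.
rewrite geq_max => /andP[Mi Pi]; rewrite -comb_delta /comb big_ord_recr/= [e]splitr.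
apply: norm_leD; first by have := uM _ Mi; rewrite -comb_delta.
apply: norm_leW (norm_leZ (u i s) dc).
by rewrite -ler_pdivlMr//; exact: uP.
Qed.

Definition slice (s t : nat) x := crop (fun n => s <= n < t)%N x.

(** Having chosen a vector, cut it where its tail is negligible, and take the
next vector so far that its coordinates below the cut are negligible. The extra
property [P] is any one satisfied by all sufficiently late terms. *)
Lemma gliding_hump u (h : nat -> R) (P : nat -> nat -> nat -> Prop) :
  (forall i, regular N (u i)) -> coord_null u -> (forall i, 0 < h i) ->
  (forall i s, exists M : nat, forall l, (M <= l)%N -> P i s l) ->
  exists f s, [/\ {homo f : i j / (i < j)%N}, {homo s : i j / (i < j)%N},
    (forall i, norm_le N (u (f i) - slice (s i) (s i.+1) (u (f i))) (h i))
    & forall i, P i (s i) (f i)].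
Proof.
move=> ru u0 h0 HP.
pose Q i s l s' := norm_le N (u l - slice s s' (u l)) (h i) /\ P i s l.
have [|f [s [fi si fP]]] := @gliding_choice Q.
  move=> i s l0; have h2 : 0 < h i / 2 by rewrite divr_gt0.
  have [M uM] := coord_null_head s u0 h2; have [M' PM'] := HP i s.
  pose l := maxn l0 (maxn M M').
  have [t ut] := ru l _ h2; exists l, (maxn s.+1 t); split.
  - exact: leq_maxl.
  - exact: leq_maxl.
  split; last by apply: PM'; rewrite /l !leq_max leqnn !orbT.
  set s' := maxn _ _; rewrite [h i]splitr.
  have -> : u l - slice s s' (u l) = crop (fun n => n < s)%N (u l)
      + crop (fun n => s' <= n)%N (u l).
    apply/funext => n.
    change (u l n - slice s s' (u l) n = crop (fun n => n < s)%N (u l) n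
      + crop (fun n => s' <= n)%N (u l) n).
    rewrite /slice /crop.
    have ss' : (s < s')%N by exact: leq_maxl.
    case: (ltnP n s) => ns /=.
      by rewrite leqNgt (ltn_trans ns ss')/= subr0 addr0.
    by case: (ltnP n s') => ns'; rewrite ?subrr ?subr0 ?add0r.
  apply: norm_leD; first by apply: uM; rewrite /l !leq_max leqnn !orbT.
  apply: (sl_lattice NDq) ut => n; rewrite /crop geq_max.
  case: (leqP t n) => _; rewrite ?andbT ?andbF ?modulus0//.
  by case: (s < n)%N; rewrite ?modulus0 ?modulus_ge0.
by exists f, s; split => // i; have [] := fP i.
Qed.

Lemma blocks_slice s u :
  {homo s : i j / (i < j)%N} -> blocks s (fun i => slice (s i) (s i.+1) (u i)).
Proof. by move=> si; split=> // i n /negbTE sin; rewrite /slice /crop sin. Qed.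

Lemma blocksZ s w (z : nat -> K) :
  blocks s w -> blocks s (fun i => z i *: w i).
Proof.
move=> [si sw]; split => // i n sin.
change (z i * w i n = 0); by rewrite sw// mulr0.
Qed.

(** Rescaling vectors against coefficients normalises blocks to the bound 1 used
in the structure above. *)
Lemma comb_rescale a w n (r : R) : r != 0 ->
  comb a w n = comb (fun i => of_real k r * a i) (fun i => of_real k r^-1 *: w i) n.
Proof.
move=> r0; apply: eq_comb => i _; rewrite scalerA mulrAC -of_realM mulfV//.
by rewrite of_real1 mul1r.
Qed.

Lemma combZ a u n (z : K) : comb (fun i => z * a i) u n = z *: comb a u n.
Proof. by rewrite /comb scaler_sumr; apply: eq_bigr => i _; rewrite scalerA. Qed.

(** Along a gliding hump the humps [w i] may be required to have coordinates so
small that [sl_upper] applies to them; what is left over of the vectors is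
summable in norm and is absorbed because each coefficient is bounded by the norm
of the combination of the model basis. *)
Lemma sup_null_upper u B : 0 < B ->
  (forall i, regular N (u i)) -> (forall i, norm_le N (u i) B) -> sup_null u ->
  exists2 f, {homo f : i j / (i < j)%N} & coord_dominates D delta N (u \o f).
Proof.
move=> B0 ru uB u0.
have cu0 : coord_null u.
  by move=> n e /u0[M uM]; exists M => i /uM.
have h0 i : 0 < (2^-1 : R) ^+ i.+1 by rewrite exprn_gt0.
pose P i s l := forall m, s%:R * modulus (u l m) <= B * 2^-1 ^+ i.+1.
have [|f [s [fi si us sB]]] := gliding_hump (P := P) ru cu0 h0.
  move=> i s; have s1 : 0 < s%:R + 1 :> R by rewrite ltr_wpDl.
  have [M uM] := u0 _ (divr_gt0 (mulr_gt0 B0 (h0 i)) s1).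
  exists M => l Ml m; have := uM l Ml m; rewrite ler_pdivlMr// mulrC.
  by apply: le_trans; rewrite ler_wpM2r ?modulus_ge0// lerDl.
exists f => //; exists (2 * B + 1); first by rewrite ltr_wpDl// mulr_ge0// ltW.
move=> n a c ac; set v := u \o f.
pose w i := slice (s i) (s i.+1) (v i).
have bw : blocks s w by exact: blocks_slice.
have c0 := norm_le_ge0 ac.
rewrite -[comb a v n](subrK (comb a w n)) addrC mulrDl mul1r.
apply: norm_leD; last first.
  rewrite -[c]mulr1; apply: comb_perturbation (us) (coord_bounded_comb ac) _ => //.
  exact: sum_half_le1.
rewrite (comb_rescale a w n (lt0r_neq0 B0)) -mulrA.
have wB i : norm_le N (w i) B by apply: norm_le_crop; exact: uB.
apply: (sl_upper NDq (blocksZ _ bw)).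
- move=> i; rewrite -[1](mulVf (lt0r_neq0 B0)).
  by apply: norm_leZr => //; rewrite invr_ge0 ltW.
- move=> i m; change (scalar_field R k) with K.
  rewrite [X in modulus X](_ : _ = of_real k B^-1 * w i m)//.
  rewrite modulusM modulus_of_real ger0_norm; last by rewrite invr_ge0 ltW.
  rewrite mulrCA ler_pdivrMl//.
  apply: le_trans (sB i m); rewrite ler_wpM2l// /w /slice /crop.
  by case: ifP; rewrite ?modulus0 ?modulus_ge0.
- by rewrite combZ; apply: norm_leZr => //; exact: ltW.
Qed.

(** Let [m] be the norm of the combination of the model basis. [sl_lower] bounds the
combination of the humps from below by [m * (d / 2)]. The left-over part costs at
most [m * (d / 4)], half of this bound, and can be moved to the other side. *)
Lemma coord_null_lower u d : 0 < d ->
  (forall i, regular N (u i)) -> (forall i, ~ norm_le N (u i) d) ->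
  coord_null u ->
  exists2 f, {homo f : i j / (i < j)%N} & coord_dominates N (u \o f) D delta.
Proof.
move=> d0 ru ud u0.
have d4 : 0 < d / 4 by rewrite divr_gt0.
have h0 i : 0 < d / 4 * 2^-1 ^+ i.+1 by rewrite mulr_gt0// exprn_gt0.
have [|f [s [fi si us _]]] := gliding_hump (P := fun _ _ _ => True) ru u0 h0.
  by move=> i s; exists 0%N.
exists f => //; exists (4 / d); first by rewrite divr_gt0.
move=> n a c ac; set v := u \o f in ac *.
pose w i := slice (s i) (s i.+1) (v i).
have bw : blocks s w by exact: blocks_slice.
have [c0 aD] : exists c0, norm_le D (comb a delta n) c0.
  rewrite /comb; exists (\sum_(i < n) modulus (a i) * fine (D (delta i))).
  apply: norm_le_sum => i _ _; apply: norm_leZ; rewrite /norm_le fineK//.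
  by rewrite fin_numElt enorm_delta andbT; apply: lt_le_trans (enorm_ge0 D _).
pose m := fine (D (comb a delta n)).
have Dm : D (comb a delta n) = m%:E.
  rewrite /m fineK// fin_numElt (norm_le_lty aD) andbT.
  by apply: lt_le_trans (enorm_ge0 D _).
have {}aD : norm_le D (comb a delta n) m by rewrite /norm_le Dm.
have m0 := norm_le_ge0 aD.
have aw : norm_le N (comb a w n) (c + m * (d / 4)).
  rewrite -[comb a w n](subKr (comb a v n)); apply: norm_leB => //.
  apply: comb_perturbation us (coord_bounded_comb aD) _ => //.
  by rewrite -mulr_sumr -[leRHS]mulr1 ler_wpM2l//; [exact: ltW|exact: sum_half_le1].
have d2 : d / 2 != 0 by rewrite lt0r_neq0// divr_gt0.
rewrite (comb_rescale a w n d2) in aw.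
have := sl_lower NDq (blocksZ _ bw) _ aw; rewrite combZ => H.
have {}H : norm_le D (of_real k (d / 2) *: comb a delta n) (c + m * (d / 4)).
  apply: H => i; rewrite invf_div => wi; apply: (ud (f i)).
  rewrite -[u (f i)](subrK (w i)) addrC [d]splitr; apply: norm_leD; last first.
    apply: norm_leW (us i); apply: (@le_trans _ _ (d / 4)); last by lra.
    rewrite -[leRHS]mulr1 ler_wpM2l//; first exact: ltW.
    by rewrite exprn_ile1// invf_le1// ler1n.
  have := norm_leZr (r := d / 2) _ wi; rewrite scalerA -of_realM mulr1.
  rewrite (_ : d / 2 * (2 / d) = 1) ?of_real1 ?scale1r; last first.
    by field; exact: lt0r_neq0.
  by apply; rewrite divr_ge0// ltW.
move: H; rewrite /norm_le enormZ modulus_of_real ger0_norm; last first.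
  by rewrite divr_ge0// ltW.
rewrite Dm -EFinM !lee_fin => H.
rewrite mulrAC ler_pdivlMr//; lra.
Qed.

End schreier_like_spaces.
(** * Blocks and dyadic averages *)

Lemma sum_single (V : nmodType) (f : nat -> V) i0 n :
  (forall i, i != i0 -> f i = 0) ->
  \sum_(i < n) f i = if (i0 < n)%N then f i0 else 0.
Proof.
move=> H; case: ltnP => [i0n|ni0]; last first.
  rewrite big1// => i _; apply: H; rewrite ltn_eqF//.
  exact: leq_trans (ltn_ord i) ni0.
rewrite (bigD1 (Ordinal i0n))//= big1 ?addr0// => i ii0; apply: H.
by apply: contra ii0 => /eqP ii0; apply/eqP/val_inj.
Qed.

Lemma sum_interval (V : nmodType) (f : nat -> V) s t n : (t <= n)%N ->
  \sum_(i < n) (if (s <= i < t)%N then f i else 0) = \sum_(s <= i < t) f i.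
Proof.
move=> tn; rewrite (big_nat_widen _ _ _ _ _ tn) (big_nat_widenl _ 0)//.
rewrite -(big_mkord xpredT (fun i => if (s <= i < t)%N then f i else 0)).
by rewrite [RHS]big_mkcond/=; apply: eq_bigr => i _; rewrite andbC.
Qed.

Lemma increasing_blocks_unique (s : nat -> nat) m :
  {homo s : i j / (i < j)%N} ->
  exists i0, forall i, (s i <= m < s i.+1)%N -> i = i0.
Proof.
move=> si; have [[i0 /andP[si0 i0s]]|H] :=
  pselect (exists i, (s i <= m < s i.+1)%N); last first.
  by exists 0%N => i im; case: H; exists i.
have sle := increasing_nondecreasing si.
exists i0 => i /andP[ai ib]; apply/eqP; rewrite eqn_leq; apply/andP; split.
  rewrite leqNgt; apply/negP => /sle; rewrite leqNgt => /negP; apply.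
  exact: leq_ltn_trans i0s.
rewrite leqNgt; apply/negP => /sle; rewrite leqNgt => /negP; apply.
exact: leq_ltn_trans ib.
Qed.

Section dyadic_weights.
Context {R : realType} {k : scalars}.
Local Notation K := (scalar_field R k).
Variables (q : R) (q1 : 1 <= q).

Let q0 : 0 < q. Proof. exact: lt_le_trans q1. Qed.

(** The factor that makes a sum of [2 ^ j] unit vectors of l_q normalised. *)
Definition dyadic_weight (j : nat) : R := ((2 ^ j)%:R `^ q^-1)^-1.

Lemma dyadic_power_gt0 j : 0 < (2 ^ j)%:R `^ q^-1 :> R.
Proof. by rewrite powR_gt0// ltr0n expn_gt0. Qed.

Lemma dyadic_weight_gt0 j : 0 < dyadic_weight j.
Proof. by rewrite invr_gt0 dyadic_power_gt0. Qed.

Lemma dyadic_weight_le1 j : dyadic_weight j <= 1.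
Proof.
rewrite invf_le1 ?dyadic_power_gt0// [leLHS](_ : 1 = 1 `^ q^-1); last by rewrite powR1.
apply: ge0_ler_powR; rewrite ?nnegrE ?invr_ge0 ?ler1n ?expn_gt0//.
exact: ltW.
Qed.

Lemma dyadic_weight_powR j : dyadic_weight j `^ q = (2 ^ j)%:R^-1.
Proof.
rewrite /dyadic_weight -powRN -powRrM mulNr mulVf; last by rewrite gt_eqF.
by rewrite powR_inv1.
Qed.

Lemma dyadic_weight_null e : 0 < e ->
  exists M : nat, forall j, (M <= j)%N -> dyadic_weight j <= e.
Proof.
move=> e0; have [M eM] : exists M : nat, e^-1 `^ q <= M%:R.
  by exists (Num.truncn (e^-1 `^ q)).+1; rewrite ltW// truncnS_gt.
exists M => j Mj; rewrite /dyadic_weight -[leRHS]invrK.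
rewrite lef_pV2 ?posrE ?invr_gt0 ?dyadic_power_gt0//.
  rewrite -[leLHS](powRK _ (lt0r_neq0 q0)) ?invr_ge0 ?(ltW e0)//.
  apply: ge0_ler_powR; rewrite ?nnegrE ?powR_ge0 ?invr_ge0 ?(ltW q0)//.
  apply: le_trans eM _; rewrite ler_nat.
  by apply: leq_trans Mj _; rewrite ltnW// ltn_expl.
Qed.

Lemma of_real_sum (I : Type) (r : seq I) (P : pred I) (f : I -> R) :
  of_real k (\sum_(i <- r | P i) f i) = \sum_(i <- r | P i) of_real k (f i).
Proof. by apply: big_morph; [exact: of_realD|exact: of_real0]. Qed.

(** The coefficients, with respect to [v], of the sum of the normalised dyadic
averages with labels [m n, ..., m (2n - 1)]. The dyadic intervals are disjoint,
so the q-th powers of the coefficients add up to the number [n] of averages. *)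
Lemma dyadic_profile (m : nat -> nat) n : {homo m : i j / (i < j)%N} ->
  exists b : nat -> R, [/\ forall i, 0 <= b i <= 1,
    forall i, b i != 0 -> (2 ^ m n <= i)%N,
    \sum_(i < 2 ^ m n.*2) b i `^ q = n%:R &
    forall v : nat -> nat -> K, comb (fun i => of_real k (b i)) v (2 ^ m n.*2) =
      \sum_(n <= j < n.*2) of_real k (dyadic_weight (m j)) *:
        \sum_(2 ^ m j <= i < 2 ^ (m j).+1) v i].
Proof.
move=> mi; pose I j i := (2 ^ m j <= i < 2 ^ (m j).+1)%N.
pose g i j : R := if (n <= j < n.*2)%N && I j i then dyadic_weight (m j) else 0.
have gE i : exists j0, forall j, j != j0 -> g i j = 0.
  have [|j0 Hj0] := @increasing_blocks_unique (fun j => 2 ^ m j)%N i.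
    by move=> x y xy; rewrite ltn_exp2l// mi.
  exists j0 => j jj0; rewrite /g; case: ifP => // /andP[_ /andP[ji ij]].
  move/eqP: jj0 => []; apply: Hj0; rewrite ji/=; apply: leq_trans ij _.
  by rewrite leq_exp2l// mi.
have g0 i j : 0 <= g i j <= 1.
  by rewrite /g; case: ifP; rewrite ?lexx ?ler01// dyadic_weight_le1 ltW ?dyadic_weight_gt0.
have le2n j : (j < n.*2)%N -> (2 ^ (m j).+1 <= 2 ^ m n.*2)%N.
  by move=> jn; rewrite leq_exp2l// mi.
exists (fun i => \sum_(j < n.*2) g i j); split.
- move=> i; have [j0 /(sum_single n.*2) ->] := gE i.
  by case: ifP; rewrite ?lexx ?ler01.
- move=> i; apply: contraNT; rewrite -ltnNge => im.
  rewrite big1// => j _; rewrite /g; case: ifP => // /andP[/andP[nj _] /andP[ji _]].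
  have := leq_trans ji (ltnW im); rewrite leq_exp2l// => mji.
  have := increasing_nondecreasing mi nj => mnj.
  by have := leq_ltn_trans ji im; rewrite ltn_exp2l// ltnNge mnj.
- have -> : \sum_(i < 2 ^ m n.*2) (\sum_(j < n.*2) g i j) `^ q =
      \sum_(i < 2 ^ m n.*2) \sum_(j < n.*2) g i j `^ q.
    apply: eq_bigr => i _; have [j0 gj0] := gE i.
    rewrite (sum_single _ gj0) (@sum_single _ (fun j => g i j `^ q) j0).
      by case: ifP => // _; rewrite powR0// gt_eqF.
    by move=> j /gj0 ->; rewrite powR0// gt_eqF.
  rewrite exchange_big/=.
  transitivity (\sum_(j < n.*2) (if (n <= j < n.*2)%N then 1 else 0 : R)).
    apply: eq_bigr => j _; case: ifP => nj; last first.
      by rewrite big1// => i _; rewrite /g nj powR0// gt_eqF.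
    rewrite (eq_bigr (fun i : 'I__ => if (2 ^ m j <= i < 2 ^ (m j).+1)%N
        then (2 ^ m j)%:R^-1 else 0 : R)); last first.
      move=> i _; rewrite /g nj/= /I; case: ifP => _; last by rewrite powR0// gt_eqF.
      exact: dyadic_weight_powR.
    rewrite (@sum_interval _ (fun=> (2 ^ m j)%:R^-1)) ?le2n//.
    rewrite big_const_nat iter_addr addr0.
    rewrite expnS mul2n -[X in (X - _)%N]addnn addnK -[LHS]mulr_natr mulVf//.
  rewrite (@sum_interval _ (fun=> 1))// big_const_nat iter_addr addr0.
  by rewrite -[X in (X - _)%N]addnn addnK.
- move=> v; rewrite /comb.
  under eq_bigr do rewrite of_real_sum scaler_suml.
  rewrite exchange_big/=.
  rewrite -(@sum_interval _ (fun j => of_real k (dyadic_weight (m j)) *: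
        \sum_(2 ^ m j <= i < 2 ^ (m j).+1) v i) n n.*2 n.*2)//.
  apply: eq_bigr => j _; case: ifP => nj; last first.
    by rewrite big1// => i _; rewrite /g nj of_real0 scale0r.
  rewrite -(@sum_interval _ v _ _ (2 ^ m n.*2)) ?le2n//.
  rewrite scaler_sumr.
  apply: eq_bigr => i _; rewrite /g nj/= /I.
  by case: ifP => _; rewrite ?of_real0 ?scaler0 ?scale0r.
Qed.

End dyadic_weights.

Section large_coordinates.
Context {R : realType} {k : scalars}.
Local Notation K := (scalar_field R k).
Implicit Types (x y a : nat -> K) (c d : R) (u v w : nat -> nat -> K).
Variables (N D : extended_norm R k) (q : R).
Hypothesis NDq : schreier_like N D q.

Let q0 : 0 < q. Proof. by apply: lt_le_trans (sl_exponent NDq). Qed.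

Lemma blocks_at s w m : blocks s w ->
  exists i0, forall i, i != i0 -> w i m = 0.
Proof.
move=> [si sw]; have [i0 Hi0] := increasing_blocks_unique m si.
exists i0 => i /eqP ii0; apply: sw; apply/negP => /Hi0; exact: ii0.
Qed.

Lemma blocks_comp s w (f : nat -> nat) :
  {homo f : i j / (i < j)%N} -> blocks s w -> blocks (s \o f) (w \o f).
Proof.
move=> fi [si sw]; split; first exact: increasing_comp.
move=> i n; rewrite /= => sfn; apply: sw; apply: contra sfn => /andP[-> /=] H.
apply: leq_trans H _; exact: (increasing_nondecreasing si (fi _ _ (ltnSn i))).
Qed.

Lemma blocks_sum_coord s w n m b : blocks s w -> 0 <= b ->
  (forall i, modulus (w i m) <= b) -> modulus (\sum_(i < n) w i m) <= b.
Proof.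
move=> bw b0 wb; have [i0 /(sum_single n) ->] := blocks_at m bw.
by case: ifP; rewrite ?modulus0.
Qed.

(** Choosing one large coordinate in each block that carries a nonzero
coefficient gives a Schreier set as soon as the blocks start late compared with
their number; on it the norm of the combination is an l_q norm. *)
Lemma blocks_schreier_lower s w (pos l : nat -> nat) (b : nat -> R) n c d :
  blocks s w -> 0 <= d -> (forall i, (s i <= pos i < s i.+1)%N) ->
  (forall i, d <= modulus (w i (pos i))) -> {homo l : i j / (i < j)%N} ->
  (forall i, 0 <= b i) -> (forall i, (i < n)%N -> b i != 0 -> (n <= l i)%N) ->
  norm_le N (comb (fun i => of_real k (b i)) (w \o l) n) c ->
  d * (\sum_(i < n) b i `^ q) `^ q^-1 <= c.
Proof.
move=> bw d0 spos wd li b0 nl xc; have [si sw] := bw.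
set x := comb _ _ _ in xc.
pose r := [seq i <- iota 0 n | b i != 0].
pose F := [fset t in map (pos \o l) r]%fset.
have posi : {homo pos : i j / (i < j)%N}.
  move=> i j ij; have /andP[_ H] := spos i; have /andP[H' _] := spos j.
  apply: leq_trans H (leq_trans _ H'); exact: (increasing_nondecreasing si).
have pl_inj : injective (pos \o l).
  exact: increasing_inj (increasing_comp posi li).
have ur : uniq (map (pos \o l) r).
  by rewrite map_inj_uniq// filter_uniq// iota_uniq.
have Fr : perm_eq F (map (pos \o l) r).
  by apply: uniq_perm; rewrite ?fset_uniq// => t; rewrite inE.
have sF : schreier F.
  apply/allP => t; rewrite (perm_mem Fr) => /mapP[ i ].
  rewrite mem_filter mem_iota /= => /andP[bi lin] ->.
  rewrite (perm_size Fr) size_map size_filter.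
  apply: leq_trans (count_size _ _) _; rewrite size_iota.
  apply: leq_trans (nl _ lin bi) _; apply: ltnW; rewrite ltnS.
  exact: increasing_ge.
have := sl_schreier NDq sF xc; rewrite /schreier_mu (perm_big _ Fr)/= big_map.
apply: le_trans; rewrite -[d in leLHS](powRK d0 (lt0r_neq0 q0)).
rewrite -powRM ?powR_ge0 ?sum_powR_ge0//; apply: ge0_ler_powR.
- by rewrite invr_ge0 ltW.
- by rewrite nnegrE mulr_ge0 ?powR_ge0 ?sum_powR_ge0.
- by rewrite nnegrE sum_powR_ge0.
rewrite -(big_mkord xpredT (fun i => b i `^ q)) mulr_sumr.
rewrite [leLHS](bigID (fun i => b i != 0))/= [X in _ + X <= _]big1 ?addr0; last first.
  by move=> i /negPn/eqP ->; rewrite powR0 ?mulr0// gt_eqF.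
rewrite /r big_filter /index_iota subn0 big_seq_cond [leRHS]big_seq_cond.
apply: ler_sum => i /andP[]; rewrite mem_iota/= => lin bi.
rewrite -powRM//; apply: ge0_ler_powR; rewrite ?nnegrE ?mulr_ge0 ?modulus_ge0 ?(ltW q0)//.
rewrite /x combE.
rewrite (@sum_single _ (fun j => of_real k (b j) * (w \o l) j (pos (l i))) i).
  rewrite lin modulusM modulus_of_real ger0_norm// mulrC ler_wpM2l//.
  exact: wd.
move=> j ji; rewrite [X in _ * X](_ : _ = w (l j) (pos (l i)))// sw ?mulr0//.
have [t Ht] := increasing_blocks_unique (pos (l i)) si.
apply/negP => /Ht lj; move/eqP: ji; apply.
by apply: (increasing_inj li); rewrite lj; apply/esym/Ht.
Qed.

End large_coordinates.
(** * Coordinatewise null spreading sequences *)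

Section null_sequences.
Context {R : realType} {k : scalars}.
Local Notation K := (scalar_field R k).
Implicit Types (x y a : nat -> K) (c d : R) (u v w : nat -> nat -> K).
Variables (N D : extended_norm R k) (q : R).
Hypothesis NDq : schreier_like N D q.

Let q0 : 0 < q. Proof. by apply: lt_le_trans (sl_exponent NDq). Qed.

(** When every late term has a coordinate larger than [d], the terms behave at least
like the basis of l_q on sets of indices which are small compared with their
minimum. The normalised dyadic averages [W j] of a gliding
subsequence are bounded, by [sl_sum_blocks], and have uniformly small
coordinates, hence a subsequence of them is dominated by the model basis. Passing
to a sparse subsequence [l], allowed by the spreading property, makes the sets
of indices involved Schreier, so that the sum of [n] averages has norm of order
[n `^ q^-1]; this contradicts the growth of the model basis. *)
Lemma large_coord_null_false u B d M : 0 < B -> 0 < d ->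
  (forall i, regular N (u i)) -> (forall i, norm_le N (u i) B) ->
  coord_null u -> spreading N u ->
  (forall i, (M <= i)%N -> exists n, d < modulus (u i n)) -> False.
Proof.
move=> B0 d0 ru uB u0 su ud.
have d4 : 0 < d / 4 by rewrite divr_gt0.
(* The errors of the gliding hump add up to at most [d / 4]. *)
pose h i := d / 4 * 2^-1 ^+ i.+1.
have h0 i : 0 < h i by rewrite mulr_gt0// exprn_gt0.
have pow_le1 i : (2^-1 : R) ^+ i <= 1 by apply: exprn_ile1; lra.
have sum_h n (l : nat -> nat) : (forall i, (i <= l i)%N) ->
    \sum_(i < n) h (l i) <= d / 4.
  move=> li; rewrite -mulr_sumr -[leRHS]mulr1 ler_wpM2l//; first exact: ltW.
  apply: le_trans (sum_half_le1 R n); apply: ler_sum => i _.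
  by apply: ler_wiXn2l; [lra|lra|exact: li].
have [|f [s [fi si us fM]]] :=
    gliding_hump (P := fun _ _ l => (M <= l)%N) NDq ru u0 h0.
  by move=> i s; exists M.
pose v := u \o f; pose w i := slice (s i) (s i.+1) (v i).
have bw : blocks s w by exact: blocks_slice.
have wB i : norm_le N (w i) B by apply: (norm_le_crop NDq); exact: uB.
have rv i : regular N (v i) by exact: ru.
have [pos posP] : {pos : nat -> nat & forall i,
    d / 2 <= modulus (w i (pos i))}.
  apply: (@choice _ _ (fun i n => d / 2 <= modulus (w i n))) => i.
  have [n dn] := ud _ (fM i); exists n.
  have := sl_coord NDq n (us i).
  rewrite [X in modulus X](_ : _ = v i n - w i n)// => vw.
  have := modulusD (v i n - w i n) (w i n); rewrite subrK => vwn.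
  have : h i <= d / 4 by rewrite -[leRHS]mulr1 ler_wpM2l// ltW.
  rewrite -/(v i) in dn; lra.
have spos i : (s i <= pos i < s i.+1)%N.
  apply/negPn/negP => H; have := posP i; rewrite bw.2// modulus0; lra.
pose V j := \sum_(2 ^ j <= i < 2 ^ j.+1) v i.
pose Y j := \sum_(2 ^ j <= i < 2 ^ j.+1) w i.
pose rho : nat -> R := dyadic_weight q; pose W j := of_real k (rho j) *: V j.
have rho0 j : 0 < rho j by exact: dyadic_weight_gt0.
have shift (F : nat -> nat -> K) j :
    \sum_(2 ^ j <= i < 2 ^ j.+1) F i = \sum_(i < 2 ^ j) F (2 ^ j + i)%N.
  rewrite -{1}[(2 ^ j)%N]add0n big_addn expnS mul2n -[X in (X - _)%N]addnn addnK.
  rewrite big_mkord.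
  by apply: eq_bigr => i _; rewrite addnC.
have VY j : norm_le N (V j - Y j) d.
  rewrite /V /Y !shift -sumrB.
  apply: (@norm_leW _ _ _ _ (\sum_(i < 2 ^ j) h (2 ^ j + i)%N)).
    apply: le_trans (sum_h _ (fun i => 2 ^ j + i)%N _) _; last by lra.
    by move=> i; exact: leq_addl.
  by apply: norm_le_sum => i _ _; exact: us.
have rhoY j : norm_le N (of_real k (rho j) *: Y j) B.
  rewrite (_ : Y j = of_real k B *: \sum_(i < 2 ^ j) of_real k B^-1 *: w (2 ^ j + i)%N).
    have li : {homo (fun i => 2 ^ j + i)%N : i i' / (i < i')%N}.
      by move=> x y; rewrite ltn_add2l.
    have Bw i : norm_le N (of_real k B^-1 *: (w \o (fun i => 2 ^ j + i)%N) i) 1.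
      rewrite -[1](mulVf (lt0r_neq0 B0)); apply: norm_leZr (wB _).
      by rewrite invr_ge0 ltW.
    have H := sl_sum_blocks NDq (2 ^ j)
      (blocksZ (fun=> of_real k B^-1) (blocks_comp li bw)) Bw.
    have := norm_leZr (ltW B0) (norm_leZr (ltW (rho0 j)) H).
    by rewrite scalerA mulrC -scalerA /rho /dyadic_weight mulVf ?mulr1.
  rewrite /Y shift scaler_sumr; apply: eq_bigr => i _.
  by rewrite scalerA -of_realM mulfV ?gt_eqF// of_real1 scale1r.
have WB j : norm_le N (W j) (B + d).
  rewrite /W -[V j](subrK (Y j)) addrC scalerDr; apply: norm_leD => //.
  apply: norm_leW (norm_leZr (ltW (rho0 j)) (VY j)).
  by rewrite -[leRHS]mul1r ler_wpM2r ?(ltW d0)// dyadic_weight_le1// (sl_exponent NDq).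
have W0 : sup_null W.
  move=> e e0; have Bd : 0 < B + d by rewrite addr_gt0.
  have [P PP] := dyadic_weight_null (sl_exponent NDq) (divr_gt0 e0 Bd).
  exists P => j /PP; rewrite ler_pdivlMr// => rj n.
  apply: le_trans rj; rewrite [X in modulus X](_ : _ = of_real k (rho j) * V j n)//.
  rewrite modulusM modulus_of_real ger0_norm; last exact: ltW.
  rewrite ler_wpM2l//; first exact: ltW.
  have VYn : modulus (V j n - Y j n) <= d by exact: (sl_coord NDq n (VY j)).
  rewrite -[V j n](subrK (Y j n)) addrC.
  apply: le_trans (modulusD _ _) _; apply: lerD => //.
  rewrite /Y shift fct_sumE.
  have li : {homo (fun i => 2 ^ j + i)%N : i i' / (i < i')%N}.
    by move=> x y; rewrite ltn_add2l.
  apply: (blocks_sum_coord _ (blocks_comp li bw)); first exact: ltW.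
  by move=> i; exact: (sl_coord NDq n (wB _)).
have rW j : regular N (W j).
  by rewrite /W; apply: regularZ; apply: (regular_sum NDq).
have [m mi [C C0 CP]] :=
  sup_null_upper NDq (addr_gt0 B0 d0) rW WB W0.
(* [l] is sparse enough for the sum over the averages [n, ..., 2n - 1]: all
   their indices are at least [n], and below [2 ^ m n.*2]. *)
pose l i := (2 ^ m i.*2)%N.
have li : {homo l : i j / (i < j)%N}.
  by move=> i j ij; rewrite ltn_exp2l// mi// ltn_double.
have [C' C'0 C'P] : coord_dominates N v N (v \o l).
  have [_ H] := su _ fi; apply: (coord_dominates_trans H).
  by have [] := su _ (increasing_comp fi li).
(* [d / 8] is what makes the final inequality fail; [C'] and [C] are the
   constants of the two dominations through which it is transported. *)
have e0 : 0 < d / 8 / (C' * C) by rewrite !divr_gt0// mulr_gt0.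
have [n n0 nD] := sl_basis_growth NDq e0.
have [b [b01 bm sumb combb]] := dyadic_profile (k := k) (sl_exponent NDq) n mi.
pose Q := (2 ^ m n.*2)%N; pose nq : R := n%:R `^ q^-1.
have nq1 : 1 <= nq.
  rewrite [leLHS](_ : 1 = 1 `^ q^-1); last by rewrite powR1.
  by apply: ge0_ler_powR; rewrite ?nnegrE ?invr_ge0 ?(ltW q0)// ler1n.
have vQ : norm_le N (comb (fun i => of_real k (b i)) v Q)
    (C * (d / 8 / (C' * C) * nq)).
  rewrite /Q combb.
  have -> : \sum_(n <= j < n.*2) of_real k (dyadic_weight q (m j)) *:
      (\sum_(2 ^ m j <= i < 2 ^ (m j).+1) v i) =
      comb (crop (fun i => n <= i)%N (fun=> 1)) (W \o m) n.*2.
    by rewrite -comb_interval; apply: eq_bigr => j _; rewrite scale1r.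
  apply: CP; rewrite -comb_interval.
  by move: nD; congr norm_le; apply: eq_bigr => i _; rewrite scale1r.
have {}vQ := C'P _ _ _ vQ.
have wQ : norm_le N (comb (fun i => of_real k (b i)) (w \o l) Q)
    (d / 8 * nq + d / 4).
  rewrite -[comb _ (w \o l) Q](subKr (comb (fun i => of_real k (b i)) (v \o l) Q)).
  apply: norm_leB.
    apply: norm_leW vQ; rewrite le_eqVlt; apply/orP; left; apply/eqP.
    by field; rewrite !gt_eqF.
  rewrite -[d / 4]mul1r; apply: (comb_perturbation ler01 (h := h \o l)).
  - by move=> i; exact: us.
  - move=> i _; have /andP[bi0 bi1] := b01 i.
    by rewrite modulus_of_real ger0_norm.
  - exact: sum_h (increasing_ge li).
have lower : d / 2 * (\sum_(i < Q) b i `^ q) `^ q^-1 <= d / 8 * nq + d / 4.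
  apply: (blocks_schreier_lower NDq bw _ spos posP li _ _ wQ).
  - by rewrite divr_ge0// ltW.
  - by move=> i; have /andP[] := b01 i.
  - move=> i iQ bi; rewrite /Q /l leq_exp2l//; apply: (increasing_nondecreasing mi).
    rewrite leq_double; apply: leq_trans (increasing_ge mi n) _.
    by apply: leq_trans (bm i bi); rewrite ltnW// ltn_expl.
rewrite /Q sumb -/nq in lower.
have : d * 1 <= d * nq by rewrite ler_wpM2l// ltW.
lra.
Qed.

(** The previous lemma provides a subsequence with uniformly small coordinates,
which has a further subsequence dominated by the model basis; the spreading
property carries the domination back to the whole sequence. *)
Lemma coord_null_upper u B : 0 < B ->
  (forall i, regular N (u i)) -> (forall i, norm_le N (u i) B) ->
  coord_null u -> spreading N u -> coord_dominates D delta N u.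
Proof.
move=> B0 ru uB u0 su.
have [small|] := pselect (forall d, 0 < d -> forall M : nat, exists2 i, (M <= i)%N &
    forall n, modulus (u i n) <= d); last first.
  move=> /existsNP[d /not_implyP[d0 /existsNP[M H]]]; exfalso.
  apply: (large_coord_null_false (M := M) B0 d0 ru uB u0 su) => i Mi.
  apply: contrapT => ui; apply: H; exists i => // n.
  by rewrite leNgt; apply/negP => dn; apply: ui; exists n.
have [|f fi fP] := @subsequence_choice (fun i l => forall n, modulus (u l n) <= i.+1%:R^-1).
  by move=> i l0; exact: small.
have uf0 : sup_null (u \o f).
  move=> e e0; exists (Num.truncn e^-1).+1 => i Mi n; apply: le_trans (fP i n) _.
  rewrite -[leRHS]invrK lef_pV2 ?posrE ?invr_gt0//.
  by apply: le_trans (ltW (truncnS_gt _)) _; rewrite ler_nat ltnW.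
have [g gi Dg] := sup_null_upper NDq B0 (fun i => ru (f i)) (fun i => uB (f i)) uf0.
apply: coord_dominates_trans Dg _.
by have [] := su _ (increasing_comp fi gi).
Qed.

Lemma coord_null_equivalent u B d : 0 < B -> 0 < d ->
  (forall i, regular N (u i)) -> (forall i, norm_le N (u i) B) ->
  (forall i, ~ norm_le N (u i) d) ->
  coord_null u -> spreading N u -> coord_equivalent N u D delta.
Proof.
move=> B0 d0 ru uB ud u0 su; split; last exact: coord_null_upper uB u0 su.
have [f fi fD] := coord_null_lower NDq d0 ru ud u0.
by apply: coord_dominates_trans fD; have [] := su _ fi.
Qed.

End null_sequences.
(** * Subsymmetric sequences are coordinatewise null *)

(** Working along an ultrafilter gives limits of countably many coordinates at
once and replaces a diagonal extraction. *)
Lemma bounded_ultra_limit (R : realType) (U : set_system nat) (B : R) (r : nat -> R) :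
  UltraFilter U -> (forall i, `|r i| <= B) ->
  exists l, forall e, 0 < e -> U [set i | `|r i - l| < e].
Proof.
move=> UU rB; have UP : ProperFilter U by exact: ultra_proper.
have Ur : (r @ U) `[(- B), B]%classic.
  have UT : U setT by exact: filterT.
  change (U (r @^-1` `[(- B), B]%classic)).
  by apply: filterS UT => i _ /=; rewrite in_itv/=; have := rB i; rewrite ler_norml.
have [] := @segment_compact R (- B) B (r @ U) _ Ur.
move=> l [_ cl]; exists l => e e0.
have [//|Ue] := in_ultra_setVsetC [set i | `|r i - l| < e] UU.
have [t [/= te lt]] := cl (~` [set t | `|t - l| < e]) (ball l e) Ue (nbhsx_ballx l e e0).
by case: te; move: lt; rewrite -ball_normE/= distrC.
Qed.

(** The permutation of the indices that, inside each dyadic interval, lists the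
even indices first and the odd ones afterwards. *)
Definition dyadic_shuffle (n : nat) : nat :=
  let l := (2 ^ trunc_log 2 n)%N in let r := (n - l)%N in
  if (n < 2)%N then n
  else if (r < l./2)%N then (l + r.*2)%N else (l + (r - l./2).*2.+1)%N.

Definition dyadic_unshuffle (n : nat) : nat :=
  let l := (2 ^ trunc_log 2 n)%N in let r := (n - l)%N in
  if (n < 2)%N then n else if odd r then (l + l./2 + r./2)%N else (l + r./2)%N.

Lemma dyadic_shuffle_bij : bijective dyadic_shuffle.
Proof.
have dyadic n : (1 < n)%N -> exists j, [/\ 2 ^ trunc_log 2 n = (2 ^ j).*2,
    (0 < 2 ^ j)%N, (2 ^ j).*2 <= n & n < (2 ^ j).*2.*2]%N.
  move=> n1; have n0 : (0 < n)%N by exact: ltn_trans n1.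
  have /andP[] := trunc_log_bounds (isT : (1 < 2)%N) n0.
  have : (0 < trunc_log 2 n)%N by rewrite trunc_log_gt0.
  case: trunc_log => // j _; rewrite !expnS !mul2n => jn nj.
  by exists j; split => //; rewrite expn_gt0.
have same j n : ((2 ^ j).*2 <= n -> n < (2 ^ j).*2.*2 ->
    2 ^ trunc_log 2 n = (2 ^ j).*2)%N.
  move=> jn nj; rewrite (@trunc_log_eq 2 j.+1)//.
    by rewrite expnS mul2n.
  by rewrite !expnS !mul2n jn.
exists dyadic_unshuffle => n; case: (leqP n 1) => n1.
- by rewrite /dyadic_shuffle ltnS n1 /dyadic_unshuffle ltnS n1.
- have [j [jE j0 jn nj]] := dyadic n n1.
  rewrite /dyadic_shuffle jE ltnNge n1/= doubleK.
  case: ifP => r; rewrite /dyadic_unshuffle (same j); try lia.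
  + by rewrite doubleK; do 2?[case: ifP => ?]; lia.
  + by rewrite doubleK; do 2?[case: ifP => ?]; lia.
- by rewrite /dyadic_unshuffle ltnS n1 /dyadic_shuffle ltnS n1.
- have [j [jE j0 jn nj]] := dyadic n n1.
  rewrite /dyadic_unshuffle jE ltnNge n1/= doubleK.
  case: ifP => r; rewrite /dyadic_shuffle (same j); try lia.
  + by rewrite doubleK; do 2?[case: ifP => ?]; lia.
  + by rewrite doubleK; do 2?[case: ifP => ?]; lia.
Qed.

Lemma dyadic_shuffle_even j r : (r < 2 ^ j)%N ->
  dyadic_shuffle (2 ^ j.+1 + r) = (2 ^ j + r).*2.
Proof.
move=> rj; rewrite /dyadic_shuffle (@trunc_log_eq 2 j.+1)//; last first.
  by rewrite !expnS; lia.
have j0 : (0 < 2 ^ j)%N by rewrite expn_gt0.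
by rewrite expnS mul2n doubleK addKn rj; case: ifP => ?; lia.
Qed.

Section subsymmetric_sequences.
Context {R : realType} {k : scalars}.
Local Notation K := (scalar_field R k).
Implicit Types (x y z a : nat -> K) (c d : R) (u v w : nat -> nat -> K).
Variables (N D : extended_norm R k) (q : R).
Hypothesis NDq : schreier_like N D q.

(** [z] is a cluster point of [u] for coordinatewise convergence. *)
Definition clusters u z : Prop := forall m e M, 0 < e ->
  exists2 i, (M <= i)%N & forall n, (n < m)%N -> modulus (u i n - z n) <= e.

Lemma bounded_clusters u B : (forall i n, modulus (u i n) <= B) ->
  exists z, clusters u z.
Proof.
move=> uB; have [U [UU oU]] := ultraFilterLemma eventually_filter.
have lim n : exists t : K, forall e, 0 < e -> U [set i | modulus (u i n - t) <= e].
  have [s Hs] := bounded_ultra_limit UU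
    (fun i => le_trans (re_part_le (u i n)) (uB i n)).
  have [t Ht] := bounded_ultra_limit UU
    (fun i => le_trans (im_part_le (u i n)) (uB i n)).
  exists (of_parts s t) => e e0; have e2 : 0 < e / 2 by rewrite divr_gt0.
  apply: filterS (filterI (Hs _ e2) (Ht _ e2)) => i /= [us ut].
  by apply: le_trans (modulus_parts _ _ _) _; rewrite [e]splitr lerD// ltW.
have [z zP] := choice lim; exists z => m e M e0.
have : U [set i | forall n, (n < m)%N -> modulus (u i n - z n) <= e].
  elim: m => [|m IH]; first by apply: filterS filterT.
  apply: filterS (filterI IH (zP m e e0)) => i /= [H Hm] n.
  by rewrite ltnS leq_eqVlt => /orP[/eqP->//|/H].
have UM : U [set i | (M <= i)%N] by apply: oU; exists M.
by move=> /(filterI UM)/filter_ex[i [/= Mi H]]; exists i.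
Qed.

(** A form of the Fatou property: the head of [z] differs from the head of some
[u i] by a combination of finitely many unit vectors with tiny coefficients. *)
Lemma norm_le_clusters u z c M : clusters u z ->
  (forall i, (M <= i)%N -> norm_le N (u i) c) -> norm_le N z c.
Proof.
move=> uz uc; apply: (sl_fatou NDq) => m; apply: norm_le_gap => e e0.
have He n : exists c, 0 < c /\ norm_le N (delta n) c.
  by have [c' c'0 dc] := norm_le_delta N n; exists c'.
have [h hP] := choice He.
have s0 : 0 < \sum_(i < m) h i + 1.
  by rewrite ltr_wpDl// sumr_ge0// => i _; have [/ltW] := hP i.
have [i Mi zi] := uz m _ M (divr_gt0 e0 s0).
have -> : crop (fun n => n < m)%N z =
    crop (fun n => n < m)%N (u i) - comb (u i - z) delta m.
  by rewrite comb_delta cropD cropN opprB addrC subrK.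
apply: norm_leB; first by apply: (norm_le_crop NDq); exact: uc.
apply: (norm_leW (c := \sum_(n < m) e / (\sum_(i < m) h i + 1) * h n)).
  rewrite -mulr_sumr mulrAC ler_pdivrMr// ler_wpM2l ?(ltW e0)//.
  by rewrite lerDl.
apply: norm_le_sum => n _ _; have [hn0 dn] := hP n.
apply: norm_leW (norm_leZ _ dn); rewrite ler_wpM2r ?(ltW hn0)//.
exact: zi.
Qed.

Lemma coord_dominates_single (N1 N2 : extended_norm R k) u v :
  coord_dominates N1 u N2 v -> exists2 C, 0 < C & forall i c,
    norm_le N1 (u i) c -> norm_le N2 (v i) (C * c).
Proof.
move=> [C C0 uv]; exists C => // i c uc.
have single w : comb (fun j => (j == i)%:R) w i.+1 = w i.
  rewrite /comb big_ord_recr/= eqxx scale1r big1 ?add0r// => j _.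
  by rewrite ltn_eqF// scale0r.
by have := uv i.+1 (fun j => (j == i)%:R) c; rewrite !single; apply.
Qed.

(** Otherwise a subsequence grows so fast that it cannot be dominated term by
term by the sequence itself. *)
Lemma spreading_bounded u : (forall i, regular N (u i)) -> spreading N u ->
  exists2 B, 0 < B & forall i, norm_le N (u i) B.
Proof.
move=> ru su; have [c uc] := choice (fun i => regular_bounded (ru i)).
have c0 i : 0 <= c i by exact: norm_le_ge0 (uc i).
apply: contrapT => unbounded.
have [|f fi fP] := @subsequence_choice
    (fun i l => ~ norm_le N (u l) (i.+1%:R * c i)).
  move=> i l0; apply: contrapT => H; apply: unbounded.
  exists (i.+1%:R * c i + \sum_(j < l0) c j + 1).
    by rewrite ltr_wpDl// addr_ge0 ?sumr_ge0 ?mulr_ge0.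
  move=> j; case: (ltnP j l0) => jl0.
    apply: norm_leW (uc j); rewrite (bigD1 (Ordinal jl0))//= addrAC.
    rewrite addrCA lerDl addr_ge0// ?sumr_ge0// addr_ge0// mulr_ge0//.
  apply: (@norm_leW _ _ _ _ (i.+1%:R * c i)).
    by rewrite -addrA lerDl addr_ge0// sumr_ge0.
  by apply: contrapT => uj; apply: H; exists j.
have [C C0 H] := coord_dominates_single (proj1 (su f fi)).
have := fP (Num.truncn C); apply.
apply: norm_leW (H _ _ (uc _)); rewrite ler_wpM2r// ltW// truncnS_gt//.
Qed.

(** Otherwise a subsequence is so small that it cannot dominate the sequence
itself term by term. *)
Lemma spreading_bounded_below u : (forall i, u i <> 0) -> spreading N u ->
  exists2 d, 0 < d & forall i, ~ norm_le N (u i) d.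
Proof.
move=> u0 su.
have below i : exists d, 0 < d /\ ~ norm_le N (u i) d.
  apply: contrapT => H; apply: (u0 i); apply: (@enorm_eq0 _ _ N).
  apply/eqP; rewrite eq_le enorm_ge0 andbT.
  apply: (norm_le_gap (c := 0)) => e e0; rewrite add0r.
  by apply: contrapT => ue; apply: H; exists e.
have [d dP] := choice below.
apply: contrapT => small.
have [|f fi fP] := @subsequence_choice
    (fun i l => norm_le N (u l) (d i / i.+1%:R)).
  move=> i l0.
  have [e [e0 ei el]] : exists e, [/\ 0 < e, e <= d i / i.+1%:R &
      forall j, (j < l0)%N -> e <= d j].
    elim: l0 => [|l [e [e0 ei el]]].
      by exists (d i / i.+1%:R); split => //; rewrite divr_gt0//; have [] := dP i.
    exists (Num.min e (d l)); split.
    - by rewrite lt_min e0; have [] := dP l.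
    - by rewrite ge_min ei.
    - move=> j; rewrite ltnS leq_eqVlt ge_min => /orP[/eqP->|/el ->//].
      by rewrite lexx orbT.
  apply: contrapT => H; apply: small; exists e => // j uj.
  apply: H; exists j; last exact: norm_leW uj.
  rewrite leqNgt; apply/negP => /el ej; have [_] := dP j; apply.
  exact: norm_leW uj.
have [C C0 H] := coord_dominates_single (proj2 (su f fi)).
set i := Num.truncn C; have [di0] := dP i; apply.
apply: norm_leW (H _ _ (fP i)); rewrite mulrCA -[leRHS]mulr1.
rewrite ler_wpM2l ?(ltW di0)// ler_pdivrMr// mul1r.
by rewrite ltW// truncnS_gt.
Qed.

(** The signed coefficients that turn combinations of consecutive differences
into combinations of the sequence itself. *)
Definition alternate a : nat -> K := fun j => (-1) ^+ odd j * a j./2.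

Definition differences u : nat -> nat -> K := fun i => u i.*2 - u i.*2.+1.

Lemma comb_alternate a u n :
  comb (alternate a) u n.*2 = comb a (differences u) n.
Proof.
elim: n => [|n IH]; first by rewrite /comb !big_ord0.
rewrite doubleS /comb !big_ord_recr/= -/(comb _ _ _) IH -addrA; congr (_ + _).
rewrite /alternate /= odd_double/= uphalf_double doubleK expr0 expr1 mul1r.
by rewrite mulN1r scaleNr scalerBr.
Qed.

Lemma spreading_differences u : spreading N u -> spreading N (differences u).
Proof.
(* [g'] keeps the pairs of consecutive indices selected by [g] together. *)
move=> su g gi; pose g' j := ((g j./2).*2 + odd j)%N.
have g'i : {homo g' : i j / (i < j)%N}.
  apply: increasing_step => i; rewrite /g' /= uphalf_half.
  case: (odd i) => /=; last by rewrite add0n; lia.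
  by have := gi _ _ (ltnSn i./2); rewrite add1n; lia.
have E : differences u \o g = differences (u \o g').
  apply/funext => i; rewrite /differences /g' /= odd_double/= uphalf_double.
  by rewrite doubleK addn0 addn1.
have [[C C0 H] [C' C'0 H']] := su _ g'i.
split; [exists C|exists C'] => // n a c;
  rewrite E -!comb_alternate; [exact: H|exact: H'].
Qed.

(** Partial sums of even length are partial sums of the series of differences;
those of odd length have one more term, which is small because the coefficients
tend to 0. *)
Lemma cauchy_series_alternate a u B : 0 < B ->
  (forall i, norm_le N (u i) B) ->
  (forall e, 0 < e -> exists M : nat, forall i, (M <= i)%N -> modulus (a i) <= e) ->
  cauchy_series N a (differences u) -> cauchy_series N (alternate a) u.
Proof.
move=> B0 uB a0 ca e e0; have e3 : 0 < e / 3 by rewrite divr_gt0.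
have [M MP] := ca _ e3; have [P PP] := a0 _ (divr_gt0 e3 B0).
(* The last term of a partial sum of odd length. *)
pose rest n : nat -> K := if odd n then a n./2 *: u n.-1 else 0.
have restE n : comb (alternate a) u n = comb a (differences u) n./2 + rest n.
  rewrite -{1}[n]odd_double_half addnC /rest -comb_alternate.
  case: (boolP (odd n)) => on; last by rewrite addn0 addr0.
  rewrite addn1 {1}/comb big_ord_recr/= /alternate odd_double doubleK expr0 mul1r.
  congr (_ + _ *: u _); move: (odd_double_half n); rewrite on; lia.
have rest_le n : (P <= n./2)%N -> norm_le N (rest n) (e / 3).
  move=> Pn; rewrite /rest; case: ifP => _; last first.
    by apply: norm_leW (norm_le0 N); exact: ltW.
  apply: norm_leW (norm_leZ _ (uB _)).
  by rewrite -ler_pdivlMr//; exact: PP.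
exists (maxn M P).*2 => m n; rewrite -geq_half_double.
rewrite geq_max => /andP[Mm Pm]; case: (leqP m n) => mn; last first.
  by rewrite big_geq ?(ltnW mn)//; apply: norm_leW (norm_le0 N); exact: ltW.
have mn2 : (m./2 <= n./2)%N by exact: half_leq.
rewrite -combB// !restE opprD addrACA combB//.
rewrite (_ : e = e / 3 + (e / 3 + e / 3)); last by field.
apply: norm_leD; first exact: MP.
apply: norm_leB; apply: rest_le => //; exact: leq_trans mn2.
Qed.

Lemma alternate_shuffle_block u j :
  let c i := of_real k (2^-1 ^+ trunc_log 2 i) in
  \sum_(2 ^ j.+1 <= i < 2 ^ j.+1 + 2 ^ j)
    (alternate c \o dyadic_shuffle) i *: (u \o dyadic_shuffle) i =
  of_real k (2^-1 ^+ j) *: \sum_(r < 2 ^ j) u (2 ^ j + r).*2.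
Proof.
move=> c; rewrite -{1}[(2 ^ j.+1)%N]add0n big_addn addKn big_mkord scaler_sumr.
apply: eq_bigr => r _; rewrite addnC /= dyadic_shuffle_even//.
rewrite /alternate odd_double expr0 mul1r doubleK /c (@trunc_log_eq 2 j)//.
by rewrite leq_addr/= expnS mul2n -addnn ltn_add2l.
Qed.

(** The consecutive differences of [u] are coordinatewise null and spreading, hence
dominated by the model basis. With the dyadic coefficients their series
converges, and so does the corresponding series of [u] with alternating signs.
Permuted by [dyadic_shuffle], the latter contains, as blocks, averages of terms
of [u] with even indices. These averages tend to 0 by unconditionality, and tend
to [z] coordinatewise. *)
Lemma unconditional_spreading_limit u z B : 0 < B ->
  (forall i, regular N (u i)) -> (forall i, norm_le N (u i) B) ->
  coord_null (fun i => u i - z) -> coord_subsymmetric N u -> z = 0.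
Proof.
move=> B0 ru uB uz [uu su]; apply/funext => n; apply: contrapT => zn.
have z0 : 0 < modulus (z n).
  by rewrite lt_def modulus_ge0 andbT; apply/negP => /eqP/modulus0_eq0.
have dnull : coord_null (differences u).
  move=> m e e0; have [M MP] := uz m _ (divr_gt0 e0 (ltr0n _ 2)).
  exists M => i Mi; rewrite [X in modulus X](_ : _ =
    (u i.*2 m - z m) - (u i.*2.+1 m - z m)); last first.
    by rewrite opprB addrA subrK.
  apply: le_trans (modulusB _ _) _; rewrite [e]splitr.
  by apply: lerD; apply: MP; apply: leq_trans Mi _; lia.
have Ddiff : coord_dominates D delta N (differences u).
  apply: (coord_null_upper NDq (B := B + B)) dnull (spreading_differences su).
  - by rewrite addr_gt0.
  - by move=> i; apply: (regularD NDq) => //; rewrite -scaleN1r; exact: regularZ.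
  - by move=> i; apply: norm_leB.
set c : nat -> K := fun i => of_real k (2^-1 ^+ trunc_log 2 i).
have c0 e : 0 < e -> exists M : nat, forall i, (M <= i)%N -> modulus (c i) <= e.
  move=> /(sl_basis_dyadic NDq)[M MP]; exists M => i Mi.
  have := sl_basis_coord NDq i (MP i i.+1 Mi).
  by rewrite big_nat1 [X in modulus X](_ : _ = c i * delta i i)// /delta eqxx mulr1.
have ca := cauchy_series_dominates Ddiff (sl_basis_dyadic NDq).
have {}ca := cauchy_series_alternate B0 uB c0 ca.
have z4 : 0 < modulus (z n) / 4 by rewrite divr_gt0.
have [M MP] := uu _ ca _ dyadic_shuffle_bij _ z4.
have [P PP] := uz n _ z4.
pose j := maxn M P.
have jlt : (j < 2 ^ j)%N by exact: ltn_expl.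
have := MP (2 ^ j.+1)%N (2 ^ j.+1 + 2 ^ j)%N _.
rewrite alternate_shuffle_block => /(_ _)/(sl_coord NDq n) H.
have {}H : modulus (of_real k (2^-1 ^+ j) *
    \sum_(r < 2 ^ j) u (2 ^ j + r).*2 n) <= modulus (z n) / 4.
  have <- : (\sum_(r < 2 ^ j) u (2 ^ j + r).*2) n = \sum_(r < 2 ^ j) u (2 ^ j + r).*2 n.
    by rewrite fct_sumE.
  apply: H; rewrite expnS mul2n.
  by have := leq_maxl M P; rewrite -/j; lia.
have two0 : (2^-1 : R) ^+ j * (2 ^ j)%:R = 1.
  by rewrite natrX -exprMn mulVf ?expr1n.
have zE : z n = of_real k (2^-1 ^+ j) * \sum_(r < 2 ^ j) z n.
  rewrite sumr_const card_ord -[X in _ * X]mulr_natl mulrA.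
  have -> : ((2 ^ j)%:R : K) = of_real k (2 ^ j)%:R.
    by elim: (2 ^ j)%N => [|t IH]; rewrite ?of_real0// -addn1 !natrD of_realD of_real1 IH.
  by rewrite -of_realM two0 of_real1 mul1r.
have : modulus (z n) <= modulus (z n) / 4 + modulus (z n) / 4.
  rewrite -{1}[z n](subrK (of_real k (2^-1 ^+ j) *
    \sum_(r < 2 ^ j) u (2 ^ j + r).*2 n)).
  apply: le_trans (modulusD _ _) _; apply: lerD => //.
  rewrite {1}zE -mulrBr -sumrB modulusM modulus_of_real ger0_norm ?exprn_ge0//.
  have tE (t : R) : t = 2^-1 ^+ j * ((2 ^ j)%:R * t) by rewrite mulrA two0 mul1r.
  rewrite [leRHS]tE ler_wpM2l ?exprn_ge0//.
  apply: le_trans (modulus_sum _ _ _) _.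
  apply: (@le_trans _ _ (\sum_(r < 2 ^ j) modulus (z n) / 4)).
    apply: ler_sum => r _; rewrite -modulusN opprB; apply: PP.
    by have := leq_maxr M P; rewrite -/j; lia.
  by rewrite sumr_const card_ord [leRHS]mulr_natl.
lra.
Qed.

(** Hypotheses and conclusion are invariant under passing to a subsequence, so [u] may be
replaced by a subsequence converging coordinatewise, with a limit that has just
been shown to vanish. *)
Theorem subsymmetric_equivalent_basis u : (forall i, regular N (u i)) ->
  (forall i, u i <> 0) -> coord_subsymmetric N u -> coord_equivalent N u D delta.
Proof.
move=> ru u0 [uu su].
have [B B0 uB] := spreading_bounded ru su.
have [d d0 ud] := spreading_bounded_below u0 su.
have [z uz] := bounded_clusters (fun i n => sl_coord NDq n (uB i)).
have [|f fi fP] := @subsequence_choice (fun i l => forall n, (n < i)%N ->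
    modulus (u l n - z n) <= i.+1%:R^-1).
  by move=> i l0; exact: uz.
have vz : coord_null (fun i => (u \o f) i - z).
  move=> n e e0; exists (maxn n.+1 (Num.truncn e^-1).+1) => i.
  rewrite geq_max => /andP[ni ei]; apply: le_trans (fP i n ni) _.
  rewrite -[leRHS]invrK lef_pV2 ?posrE ?invr_gt0//.
  by apply: le_trans (ltW (truncnS_gt _)) _; rewrite ler_nat ltnW.
have uf := su f fi.
have sv : spreading N (u \o f).
  move=> g gi; apply: coord_equivalent_trans (coord_equivalent_sym uf) _.
  exact: su (increasing_comp fi gi).
have uv := coord_unconditional_equivalent uf uu.
have z0 := unconditional_spreading_limit B0 (fun i => ru (f i))
  (fun i => uB (f i)) vz (conj uv sv).
apply: coord_equivalent_trans uf _.
apply: (coord_null_equivalent NDq B0 d0 (fun i => ru (f i))) sv => // n e e0.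
have [M MP] := vz n e e0; exists M => i /MP.
by rewrite z0 subr0.
Qed.

End subsymmetric_sequences.
(** * Sequences equivalent to the model basis *)

Section converse.
Context {R : realType} {k : scalars}.
Local Notation K := (scalar_field R k).
Implicit Types (x y z a : nat -> K) (c d : R) (u v w : nat -> nat -> K).
Variables (N D : extended_norm R k) (q : R).
Hypothesis NDq : schreier_like N D q.

(** A sum of late terms of the permuted series is a part of a sum of late terms
of the original one, and the norm is a lattice norm. *)
Lemma basis_unconditional : coord_unconditional D delta.
Proof.
move=> a ca s [s' s'K sK] e e0; have [M MP] := ca e e0.
(* Beyond this index, [s] takes no value below [M]. *)
exists (\max_(j < M) s' j).+1 => m n Mm.
pose Q := (\max_(i < n) s i).+1.
apply: (sl_basis_lattice NDq) (MP M Q (leqnn M)) => t.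
rewrite !comb_interval comb_delta combE.
rewrite (@sum_single _ (fun i => crop (fun i => m <= i)%N (a \o s) i *
    (delta \o s) i t) (s' t)); last first.
  move=> i /eqP it; rewrite /= /delta; case: eqP => [ts|]; last by rewrite mulr0.
  by case: it; rewrite ts s'K.
case: ifP => tn; last by rewrite modulus0 modulus_ge0.
rewrite /= /delta sK eqxx mulr1 /crop /=; case: ifP => mt; last first.
  by rewrite modulus0 modulus_ge0.
rewrite sK; have -> : (t < Q)%N.
  by rewrite ltnS -[t]sK; exact: (leq_bigmax (Ordinal tn)).
case: leqP => // tM; have := leq_bigmax (F := fun j : 'I_M => s' j) (Ordinal tM).
by move=> /= /leq_ltn_trans/(_ Mm); rewrite ltnNge mt.
Qed.

Theorem equivalent_basis_subsymmetric u :
  coord_equivalent N u D delta -> coord_subsymmetric N u.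
Proof.
move=> uD; split; first exact: (coord_unconditional_equivalent
  (coord_equivalent_sym uD) basis_unconditional).
move=> f fi; apply: (coord_equivalent_trans uD).
apply: coord_equivalent_trans (sl_basis_spreading NDq fi) _.
exact: (coord_equivalent_comp f (coord_equivalent_sym uD)).
Qed.

(** Completeness: a coordinatewise cluster point of the partial sums is the limit
in norm by the Fatou property. *)
Lemma cauchy_series_limit u a : (forall i, regular N (u i)) ->
  cauchy_series N a u -> exists2 x, regular N x & forall e, 0 < e ->
    exists M : nat, forall n, (M <= n)%N -> norm_le N (x - comb a u n) e.
Proof.
move=> ru ca; have [P PP] := ca 1 ltr01.
have [b Pb] := regular_bounded (regular_comb NDq a P ru).
pose v i := comb a u (P + i).
have vb i : norm_le N (v i) (1 + b).
  rewrite -[v i](subrK (comb a u P)); apply: norm_leD => //.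
  by rewrite combB ?leq_addr//; exact: PP.
have [z vz] := bounded_clusters (fun i n => sl_coord NDq n (vb i)).
have lim e : 0 < e -> exists M : nat, forall n, (M <= n)%N ->
    norm_le N (z - comb a u n) e.
  move=> e0; have [M MP] := ca e e0; exists M => n Mn.
  apply: (norm_le_clusters NDq (u := fun i => v i - comb a u n) (M := n)).
    move=> m d t d0; have [i ti vi] := vz m d t d0; exists i => // j jm.
    apply: le_trans (vi j jm).
    set t' := comb a u n.
    rewrite [X in modulus X](_ : _ = (v i j - t' j) - (z j - t' j))//.
    by rewrite opprB addrA subrK.
  move=> i ni; rewrite combB; first exact: MP.
  exact: leq_trans ni (leq_addl _ _).
exists z => // e e0; have e2 : 0 < e / 2 by rewrite divr_gt0.
have [M MP] := lim _ e2.
have [m mP] := regular_comb NDq a M ru e2; exists m.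
rewrite -[z](subrK (comb a u M)) cropD [e]splitr; apply: norm_leD => //.
by apply: (norm_le_crop NDq); exact: MP.
Qed.

End converse.

(** * Transfer to normed spaces *)

Section coordinates.
Context {R : realType} {k : scalars}.
Local Notation K := (scalar_field R k).
Implicit Types (c d : R).

(** A linear isometric embedding of [V] into the scalar sequences with the norm
[N], isometry being expressed through upper bounds. *)
Record coordinates (N : extended_norm R k) (V : normedModType K)
    (iota : V -> nat -> K) : Prop := Coordinates {
  coordinatesD : forall x y, iota (x + y) = iota x + iota y;
  coordinatesZ : forall (a : K) x, iota (a *: x) = a *: iota x;
  coordinates_norm : forall x c, norm_le N (iota x) c <-> `|x| <= of_real k c }.

Lemma of_real_gt0 c : (0 < of_real k c) = (0 < c).
Proof.
rewrite !lt_def -(of_real0 k) le_of_real; congr (~~ _ && _).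
by apply/eqP/eqP => [/of_real_inj|->].
Qed.

Lemma gt0_of_real (e : K) : 0 < e -> e = of_real k (modulus e).
Proof. by move=> e0; rewrite -norm_modulus gtr0_norm. Qed.

Lemma normv_of_real (V : normedModType K) (x : V) : `|x| = of_real k (modulus `|x|).
Proof. by rewrite -norm_modulus normr_id. Qed.

Section embedding.
Context {N : extended_norm R k} {V : normedModType K} {iota : V -> nat -> K}.
Hypothesis Vi : coordinates N iota.

Lemma coordinates0 : iota 0 = 0.
Proof. by rewrite -(scale0r (0 : V)) (coordinatesZ Vi) scale0r. Qed.

Lemma coordinatesB x y : iota (x - y) = iota x - iota y.
Proof.
by rewrite (coordinatesD Vi) -scaleN1r (coordinatesZ Vi) scaleN1r.
Qed.

Lemma coordinates_comb (a : nat -> K) (u : nat -> V) n :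
  iota (\sum_(i < n) a i *: u i) = comb a (iota \o u) n.
Proof.
rewrite /comb; elim: n => [|n IH]; first by rewrite !big_ord0 coordinates0.
by rewrite !big_ord_recr/= (coordinatesD Vi) (coordinatesZ Vi) IH.
Qed.

Lemma coordinates_eq0 x : iota x = 0 -> x = 0.
Proof.
move=> x0; apply/normr0_eq0/eqP; rewrite eq_le normr_ge0 andbT -(of_real0 k).
by apply/(coordinates_norm Vi); rewrite x0; exact: norm_le0.
Qed.

Context {D : extended_norm R k} {q : R}.
Hypothesis NDq : schreier_like N D q.
Hypothesis V_regular : forall x, regular N x <-> exists v, iota v = x.

(** The equivalence uses completeness, which is where the image of the embedding
must consist of all the regular vectors. *)
Lemma cvg_series_coord (u : nat -> V) (a : nat -> K) :
  cvgn (series (fun n => a n *: u n)) <-> cauchy_series N a (iota \o u).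
Proof.
have seriesE n : series (fun n => a n *: u n) n = \sum_(i < n) a i *: u i.
  by rewrite /series/= big_mkord.
split=> [/cvg_ex[l /cvgrPdist_lt ul] e e0|ca].
  have e2 : 0 < of_real k (e / 2) by rewrite of_real_gt0 divr_gt0.
  have [M _ MP] := ul _ e2; exists M => m n Mm.
  case: (leqP m n) => mn; last first.
    by rewrite big_geq ?(ltnW mn)//; apply: norm_leW (norm_le0 N); exact: ltW.
  have close j : (M <= j)%N ->
      norm_le N (iota l - comb a (iota \o u) j) (e / 2).
    move=> /MP /= lj; rewrite -coordinates_comb -coordinatesB.
    by apply/(coordinates_norm Vi)/ltW; rewrite -seriesE.
  rewrite -combB//.
  have -> : comb a (iota \o u) n - comb a (iota \o u) m =
     (iota l - comb a (iota \o u) m) - (iota l - comb a (iota \o u) n).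
    by rewrite opprB [RHS]addrC addrA subrK.
  rewrite [e]splitr; apply: norm_leB; apply: close => //.
  exact: leq_trans mn.
have ru i : regular N ((iota \o u) i) by apply/V_regular; exists (u i).
have [x rx xP] := cauchy_series_limit NDq ru ca.
have [l lx] := (V_regular x).1 rx.
apply/cvg_ex; exists l; apply/cvgrPdist_lt => e e0.
have me0 : 0 < modulus e by rewrite -of_real_gt0 -gt0_of_real.
have [M MP] := xP _ (divr_gt0 me0 (ltr0n _ 2)); exists M => // j /= Mj.
apply: (@le_lt_trans _ _ (of_real k (modulus e / 2))); last first.
  rewrite [ltRHS]gt0_of_real// lt_def le_of_real; apply/andP; split; last by lra.
  by apply/eqP => /of_real_inj; lra.
apply/(coordinates_norm Vi); rewrite coordinatesB seriesE coordinates_comb lx.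
exact: MP.
Qed.

Lemma unconditional_coord (u : nat -> V) :
  unconditional u <-> coord_unconditional N (iota \o u).
Proof.
split=> uu a ca s bs.
  by have /cvg_series_coord := uu a ((cvg_series_coord u a).2 ca) s bs.
apply/(cvg_series_coord (u \o s) (a \o s)); apply: uu => //.
exact/cvg_series_coord.
Qed.

End embedding.

Lemma dominates_coord (N1 N2 : extended_norm R k) (V1 V2 : normedModType K)
    (i1 : V1 -> nat -> K) (i2 : V2 -> nat -> K) (u : nat -> V1) (v : nat -> V2) :
  coordinates N1 i1 -> coordinates N2 i2 ->
  dominates u v <-> coord_dominates N1 (i1 \o u) N2 (i2 \o v).
Proof.
move=> V1i V2i; split=> [[C C0 uv]|[C C0 uv]].
  exists (modulus C); first by rewrite -of_real_gt0 -gt0_of_real.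
  move=> n a c; rewrite -(coordinates_comb V1i) -(coordinates_comb V2i).
  move=> /(coordinates_norm V1i) uc; apply/(coordinates_norm V2i).
  apply: le_trans (uv n a) _; rewrite of_realM -gt0_of_real//.
  by rewrite ler_wpM2l// ltW.
exists (of_real k C); first by rewrite of_real_gt0.
move=> n a; rewrite [X in _ * X]normv_of_real -of_realM.
apply/(coordinates_norm V2i); rewrite (coordinates_comb V2i); apply: uv.
rewrite -(coordinates_comb V1i); apply/(coordinates_norm V1i).
by rewrite -normv_of_real.
Qed.

Lemma equivalent_coord (N1 N2 : extended_norm R k) (V1 V2 : normedModType K)
    (i1 : V1 -> nat -> K) (i2 : V2 -> nat -> K) (u : nat -> V1) (v : nat -> V2) :
  coordinates N1 i1 -> coordinates N2 i2 ->
  equivalent u v <-> coord_equivalent N1 (i1 \o u) N2 (i2 \o v).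
Proof.
move=> V1i V2i; rewrite /equivalent (dominates_coord u v V1i V2i).
by rewrite (dominates_coord v u V2i V1i).
Qed.

Lemma basic_sequence_neq0 (V : normedModType K) (u : nat -> V) n :
  basic_sequence u -> u n <> 0.
Proof.
move=> bu un; have [|a [_ a_unique]] := bu 0.
  by apply: subset_closure; exists 0%N, (fun=> 0); rewrite big_ord0.
have null b : (forall i, b i *: u i = 0) ->
    series (fun i => b i *: u i) @ \oo --> (0 : V).
  move=> b0; have -> : series (fun i => b i *: u i) = fun=> 0.
    by apply/funext => m; rewrite /series/= big1.
  exact: cvg_cst.
have a0 := a_unique (fun=> 0) (null _ (fun i => scale0r _)).
have ad : a = delta n.
  apply: a_unique; apply: null => i; rewrite /delta.
  by case: eqP => [->|_]; rewrite ?un ?scaler0 ?scale0r.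
have := congr1 (fun b => b n) (etrans (esym a0) ad).
by rewrite /delta eqxx => /eqP; rewrite eq_sym oner_eq0.
Qed.

Theorem subsymmetric_equivalent (N D : extended_norm R k) (q : R)
    (V W : normedModType K) (iota : V -> nat -> K) (j : W -> nat -> K)
    (e : nat -> W) (u : nat -> V) :
  schreier_like N D q -> coordinates N iota ->
  (forall x, regular N x <-> exists v, iota v = x) ->
  coordinates D j -> (forall n, j (e n) = delta n) ->
  basic_sequence u -> subsymmetric u <-> equivalent u e.
Proof.
move=> NDq Vi V_regular Wj je bu.
have ru i : regular N ((iota \o u) i) by apply/V_regular; exists (u i).
have u0 i : (iota \o u) i <> 0.
  by move=> /(coordinates_eq0 Vi); exact: basic_sequence_neq0.
have jeE : j \o e = delta by apply/funext => n; exact: je.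
rewrite (equivalent_coord u e Vi Wj) jeE.
have -> : subsymmetric u <-> coord_subsymmetric N (iota \o u).
  split=> [][uu su]; split.
  - exact/(unconditional_coord Vi NDq V_regular).
  - by move=> f fi; apply/(equivalent_coord u (u \o f) Vi Vi); exact: su.
  - exact/(unconditional_coord Vi NDq V_regular).
  - by move=> f fi; apply/(equivalent_coord u (u \o f) Vi Vi); exact: su.
split; first exact: (subsymmetric_equivalent_basis NDq).
exact: (equivalent_basis_subsymmetric NDq).
Qed.

End coordinates.
(** * The model bases *)

Lemma ler_powR_cancel (R : realType) (p x y : R) :
  0 < p -> 0 <= x -> 0 <= y -> (x `^ p <= y `^ p) = (x <= y).
Proof.
move=> p0 x0 y0; apply/idP/idP => [|xy]; last first.
  by apply: ge0_ler_powR; rewrite ?nnegrE// ltW.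
rewrite leNgt [in X in _ -> X]leNgt; apply: contra => yx.
by apply: gt0_ltr_powR; rewrite ?nnegrE.
Qed.

Lemma powRV_le (R : realType) (p s c : R) : 0 < p -> 0 <= s -> 0 <= c ->
  (s `^ p^-1 <= c) = (s <= c `^ p).
Proof.
move=> p0 s0 c0; rewrite -[X in _ <= X](powRK c0 (lt0r_neq0 p0)).
by rewrite ler_powR_cancel ?powR_ge0 ?invr_gt0.
Qed.

Lemma large_power (R : realType) (r t : R) : 0 < r ->
  exists2 n, (0 < n)%N & t <= n%:R `^ r.
Proof.
move=> r0; exists (Num.truncn (`|t| `^ r^-1)).+1 => //.
apply: le_trans (ler_norm t) _.
rewrite -{1}(powRK (c := `|t|) (p := r^-1)) ?invr_neq0 ?lt0r_neq0// invrK.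
apply: ge0_ler_powR; rewrite ?nnegrE ?powR_ge0 ?(ltW r0)//.
by rewrite ltW// truncnS_gt.
Qed.

Section unit_bases.
Context {R : realType} {k : scalars}.
Local Notation K := (scalar_field R k).
Implicit Types (x y a : nat -> K) (c d : R).

Lemma comb_delta_comp a (f : nat -> nat) n : injective f ->
  forall i, (i < n)%N -> comb a (delta \o f) n (f i) = a i.
Proof.
move=> fI i lin; rewrite combE.
rewrite (@sum_single _ (fun j => a j * (delta \o f) j (f i)) i).
  by rewrite lin /delta /= eqxx mulr1.
by move=> j ji; rewrite /delta /= (inj_eq fI) eq_sym (negbTE ji) mulr0.
Qed.

Lemma comb_delta_notin a (f : nat -> nat) n t :
  (forall i, (i < n)%N -> f i != t) -> comb a (delta \o f) n t = 0.
Proof.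
move=> H; rewrite combE big1// => i _.
by rewrite /delta /= eq_sym (negbTE (H i _)) ?mulr0.
Qed.

(** The coordinates of a combination of distinct unit vectors are its
coefficients and zeros. *)
Lemma sum_comb_delta (a : nat -> K) (f : nat -> nat) (g : K -> R) n m :
  injective f -> g 0 = 0 ->
  \sum_(t < m) g (comb a (delta \o f) n t) =
  \sum_(i < n | (f i < m)%N) g (a i).
Proof.
move=> fI g0; have E t : g (comb a (delta \o f) n t) =
    \sum_(i < n) (if f i == t then g (a i) else 0).
  have [[i0 [i0n fi0]]|H] := pselect (exists i, (i < n)%N /\ f i = t).
    rewrite -fi0 comb_delta_comp// (@sum_single _
      (fun i => if f i == f i0 then g (a i) else 0) i0) ?i0n ?eqxx// => i ii0.
    by rewrite (inj_eq fI) (negbTE ii0).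
  rewrite comb_delta_notin ?g0; last first.
    by move=> i lin; apply/eqP => fi; apply: H; exists i.
  rewrite big1// => i _; case: eqP => // fi; case: H; by exists i.
under eq_bigr do rewrite E.
rewrite exchange_big/= [RHS]big_mkcond/=; apply: eq_bigr => i _.
case: ltnP => fm; last first.
  by rewrite big1// => t _; rewrite gtn_eqF// (leq_trans (ltn_ord t)).
by rewrite (@sum_single _ (fun t => if f i == t then g (a i) else 0) (f i))
  ?fm ?eqxx// => t tf; rewrite eq_sym (negbTE tf).
Qed.

Lemma comb_delta_crop n m :
  \sum_(m <= i < n) delta i = comb (crop (fun i => m <= i)%N (fun=> 1)) delta n
  :> (nat -> K).
Proof. by rewrite -comb_interval; apply: eq_bigr => i _; rewrite scale1r. Qed.

Section lp.
Variables (p : R) (p1 : 1 <= p).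
Local Notation lp := (@lp_enorm R k p p1).

Let p0 : 0 < p. Proof. exact: lt_le_trans p1. Qed.

Lemma lp_le x c : 0 <= c ->
  norm_le lp x c <-> forall m, \sum_(i < m) modulus (x i) `^ p <= c `^ p.
Proof.
move=> c0; rewrite /norm_le /= /lp_norm.
have t0 n : (0 <= (modulus (x n) `^ p)%:E)%E by rewrite lee_fin powR_ge0.
set S := (\big[_/_]_(0 <= n <oo) _).
have S0 : (0 <= S)%E by apply: nneseries_ge0 => n _ _; exact: t0.
split=> [Sc m|H].
  have Sp : (S <= (c `^ p)%:E)%E.
    have := gt0_ler_poweR (ltW p0) _ _ Sc.
    rewrite -poweRrM mulVf ?lt0r_neq0// poweRe1// poweR_EFin.
    by apply; rewrite in_itv/= leey ?poweR_ge0 ?lee_fin ?c0.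
  rewrite -lee_fin; apply: le_trans Sp; rewrite -sumEFin.
  have := nneseries_lim_ge (P := xpredT) (m := 0%N) m (fun n _ _ => t0 n).
  by rewrite big_mkord.
have Sp : (S <= (c `^ p)%:E)%E.
  apply: lime_le; first by apply: is_cvg_nneseries => n _ _; exact: t0.
  by apply: nearW => m; rewrite big_mkord sumEFin lee_fin; exact: H.
rewrite -[c](powRK c0 (lt0r_neq0 p0)) -poweR_EFin.
apply: gt0_ler_poweR => //; first by rewrite invr_ge0 ltW.
  by rewrite in_itv/= leey S0.
by rewrite in_itv/= leey lee_fin powR_ge0.
Qed.

Lemma lp_comb_le a (f : nat -> nat) n c : injective f -> 0 <= c ->
  norm_le lp (comb a (delta \o f) n) c <->
  \sum_(i < n) modulus (a i) `^ p <= c `^ p.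
Proof.
move=> fI c0; have g0 : modulus (0 : K) `^ p = 0.
  by rewrite modulus0 powR0// lt0r_neq0.
rewrite lp_le//; split => [/(_ (\max_(i < n) f i).+1)|H m].
  rewrite (@sum_comb_delta a f (fun z => modulus z `^ p) n _ fI g0); apply: le_trans.
  rewrite le_eqVlt; apply/orP; left; apply/eqP; apply: eq_bigl => i.
  by apply/esym; rewrite ltnS; exact: leq_bigmax.
rewrite (@sum_comb_delta a f (fun z => modulus z `^ p) n m fI g0); apply: le_trans H.
by rewrite big_mkcond; apply: ler_sum => i _; case: ifP; rewrite ?powR_ge0.
Qed.

Lemma lp_lattice x y c : (forall n, modulus (x n) <= modulus (y n)) ->
  norm_le lp y c -> norm_le lp x c.
Proof.
move=> xy yc; have c0 := norm_le_ge0 yc; apply/(lp_le _ c0) => m.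
apply: le_trans ((lp_le _ c0).1 yc m); apply: ler_sum => i _.
by rewrite ler_powR_cancel ?modulus_ge0.
Qed.

Lemma lp_coord x c n : norm_le lp x c -> modulus (x n) <= c.
Proof.
move=> xc; have c0 := norm_le_ge0 xc.
rewrite -(ler_powR_cancel p0) ?modulus_ge0//.
apply: le_trans ((lp_le _ c0).1 xc n.+1); rewrite big_ord_recr/= lerDr.
exact: sum_powR_ge0.
Qed.

Lemma lp_spreading : spreading lp delta.
Proof.
move=> f /increasing_inj fI.
split; exists 1 => // n a c ac; have c0 := norm_le_ge0 ac; rewrite mul1r.
  by apply/(lp_comb_le _ _ fI c0)/(lp_comb_le _ _ (@inj_id nat) c0).
by apply/(lp_comb_le _ _ (@inj_id nat) c0)/(lp_comb_le _ _ fI c0).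
Qed.

Lemma lp_growth e : 1 < p -> 0 < e -> exists2 n, (0 < n)%N &
  norm_le lp (\sum_(n <= i < n.*2) delta i) (e * n%:R `^ 1^-1).
Proof.
move=> pgt1 e0; have pm1 : 0 < p - 1 by rewrite subr_gt0.
have [n n0 nP] := large_power (e `^ p)^-1 pm1; exists n => //.
have en0 : 0 <= e * n%:R by rewrite mulr_ge0// ltW.
rewrite invr1 powRr1// comb_delta_crop.
apply/(lp_comb_le _ _ (@inj_id nat) en0).
rewrite powRM ?(ltW e0)// -[X in _ <= _ * X]mulr_powRB1// mulrCA.
apply: (@le_trans _ _ (n%:R * 1)); last first.
  by rewrite ler_wpM2l// -ler_pdivrMl ?powR_gt0// mulr1.
rewrite mulr1 (eq_bigr (fun i : 'I__ => if (n <= i < n.*2)%N then 1 else 0)).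
  rewrite (@sum_interval _ (fun=> 1))// big_const_nat iter_addr addr0.
  by rewrite -addnn addnK.
move=> i _; rewrite ltn_ord andbT /crop; case: ifP => _.
  by rewrite modulus1 powR1.
by rewrite modulus0 powR0// lt0r_neq0.
Qed.

(** The p-th powers of the coefficients add up to [r ^+ j] over the dyadic interval
of length [2 ^ j], where [r < 1] because [1 < p]. *)
Lemma lp_dyadic : 1 < p ->
  cauchy_series lp (fun i => of_real k (2^-1 ^+ trunc_log 2 i)) delta.
Proof.
move=> pgt1 e e0; pose c i : R := 2^-1 ^+ trunc_log 2 i.
have h0 : (0 : R) <= 2^-1 by rewrite invr_ge0.
pose r : R := 2 * 2^-1 `^ p.
have r0 : 0 <= r by rewrite mulr_ge0// powR_ge0.
have r1 : r < 1.
  rewrite /r -mulr_powRB1// mulrA mulfV// mul1r.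
  rewrite [ltRHS](_ : 1 = 1 `^ (p - 1)); last by rewrite powR1.
  by apply: gt0_ltr_powR; rewrite ?subr_gt0 ?nnegrE// invf_lt1// ltr1n.
have block j : \sum_(2 ^ j <= i < 2 ^ j.+1) c i `^ p = r ^+ j.
  rewrite (eq_big_nat _ _ (F2 := fun=> (2^-1 ^+ j) `^ p)); last first.
    by move=> i ij; rewrite /c (trunc_log_eq _ ij).
  rewrite big_const_nat iter_addr addr0 expnS mul2n -[X in (X - _)%N]addnn addnK.
  rewrite -[LHS]mulr_natl.
  rewrite natrX /r exprMn; congr (_ * _).
  by rewrite -(powR_mulrn j h0) -(powR_mulrn j (powR_ge0 _ _)) powRAC.
have sum_blocks j0 j1 : (j0 <= j1)%N ->
    \sum_(2 ^ j0 <= i < 2 ^ j1) c i `^ p <= r ^+ j0 / (1 - r).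
  move=> j01; suff : (1 - r) * \sum_(2 ^ j0 <= i < 2 ^ j1) c i `^ p
      = r ^+ j0 - r ^+ j1.
    move=> H; rewrite ler_pdivlMr ?subr_gt0// mulrC H gerBl.
    exact: exprn_ge0.
  elim: j1 j01 => [|j IH].
    by rewrite leqn0 => /eqP ->; rewrite big_geq// mulr0 subrr.
  rewrite leq_eqVlt => /orP[/eqP->|]; first by rewrite big_geq// mulr0 subrr.
  rewrite ltnS => j0j; rewrite (@big_cat_nat _ _ _ (2 ^ j)) ?leq_exp2l//=.
  by rewrite mulrDr IH// block exprS; ring.
have d0 : 0 < (1 - r) * e `^ p by rewrite mulr_gt0 ?subr_gt0 ?powR_gt0.
have /cvgrPdist_lt/(_ _ d0)[J _ JP] : (GRing.exp r : R^nat) @ \oo --> 0.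
  by apply: cvg_expr; rewrite ger0_norm.
have {JP} : r ^+ J < (1 - r) * e `^ p.
  by have := JP J (leqnn J); rewrite sub0r normrN ger0_norm// exprn_ge0.
rewrite mulrC -ltr_pdivrMr ?subr_gt0// => /ltW JP.
exists (2 ^ J)%N => m n Jm; rewrite comb_interval.
apply/(lp_comb_le _ _ (@inj_id nat) (ltW e0)); apply: le_trans JP.
apply: le_trans (sum_blocks J (maxn J n) (leq_maxl _ _)).
have nle : (n <= 2 ^ maxn J n)%N.
  by apply: leq_trans (ltnW (ltn_expl _ (isT : (1 < 2)%N))); exact: leq_maxr.
rewrite -(@sum_interval _ (fun i => c i `^ p) _ _ _ (leqnn _)).
rewrite (big_ord_widen _ (fun i => modulus (crop _ _ i) `^ p) nle) big_mkcond/=.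
apply: ler_sum => i _; rewrite /crop ltn_ord andbT.
case: ltnP => _; last by case: ifP; rewrite ?powR_ge0.
case: leqP => mi; last first.
  by rewrite modulus0 powR0 ?lt0r_neq0//; case: ifP; rewrite ?powR_ge0.
by rewrite (leq_trans Jm mi) modulus_of_real ger0_norm// exprn_ge0.
Qed.

End lp.

Local Notation linf := (linfty_enorm R k).

Lemma linfty_le x c : norm_le linf x c <-> forall n, modulus (x n) <= c.
Proof.
split=> [xc n|H].
  rewrite -lee_fin; apply: le_trans xc.
  by apply: ereal_sup_ubound; exists n.
by apply: ge_ereal_sup => _ [n _ <-]; rewrite lee_fin.
Qed.

Lemma linfty_comb_le a (f : nat -> nat) n c : injective f -> 0 <= c ->
  norm_le linf (comb a (delta \o f) n) c <->
  forall i, (i < n)%N -> modulus (a i) <= c.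
Proof.
move=> fI c0; rewrite linfty_le; split=> [H i lin|H t].
  by rewrite -(comb_delta_comp a fI lin).
have [[i [lin <-]]|E] := pselect (exists i, (i < n)%N /\ f i = t).
  by rewrite comb_delta_comp//; exact: H.
rewrite comb_delta_notin ?modulus0// => i lin.
by apply/eqP => fi; apply: E; exists i.
Qed.

Lemma linfty_spreading : spreading linf delta.
Proof.
move=> f /increasing_inj fI.
split; exists 1 => // n a c ac; have c0 := norm_le_ge0 ac; rewrite mul1r.
  by apply/(linfty_comb_le _ _ fI c0)/(linfty_comb_le _ _ (@inj_id nat) c0).
by apply/(linfty_comb_le _ _ (@inj_id nat) c0)/(linfty_comb_le _ _ fI c0).
Qed.

Lemma linfty_growth (p e : R) : 1 <= p -> 0 < e -> exists2 n, (0 < n)%N &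
  norm_le linf (\sum_(n <= i < n.*2) delta i) (e * n%:R `^ p^-1).
Proof.
move=> p1 e0; have p0 : 0 < p by exact: lt_le_trans p1.
have pV0 : 0 < p^-1 by rewrite invr_gt0.
have [n n0 nP] := large_power e^-1 pV0; exists n => //.
have en0 : 0 <= e * n%:R `^ p^-1 by rewrite mulr_ge0 ?powR_ge0// ltW.
rewrite comb_delta_crop; apply/(linfty_comb_le _ _ (@inj_id nat) en0) => i _.
apply: (@le_trans _ _ 1); last by rewrite -ler_pdivrMl// mulr1.
by rewrite /crop; case: ifP; rewrite ?modulus1 ?modulus0.
Qed.

Lemma linfty_dyadic :
  cauchy_series linf (fun i => of_real k (2^-1 ^+ trunc_log 2 i)) delta.
Proof.
move=> e e0; have h0 : (0 : R) <= 2^-1 by rewrite invr_ge0.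
have /cvgrPdist_lt/(_ _ e0)[J _ JP] : (GRing.exp 2^-1 : R^nat) @ \oo --> 0.
  by apply: cvg_expr; rewrite ger0_norm// invf_lt1// ltr1n.
exists (2 ^ J)%N => m n Jm; rewrite comb_interval.
apply/(linfty_comb_le _ _ (@inj_id nat) (ltW e0)) => i _.
rewrite /crop; case: leqP => mi; last by rewrite modulus0 ltW.
rewrite modulus_of_real ger0_norm ?exprn_ge0//.
have Ji : (J <= trunc_log 2 i)%N by apply: trunc_log_max => //; exact: leq_trans mi.
have := JP _ Ji; rewrite sub0r normrN ger0_norm ?exprn_ge0//.
exact: ltW.
Qed.

End unit_bases.
(** * Schreier sets against blocks *)

Section finite_seminorms.
Context {R : realType} {k : scalars}.
Local Notation K := (scalar_field R k).
Implicit Types (x y a : nat -> K) (c d : R) (w : nat -> nat -> K)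
  (F : {fset nat}).

Lemma crop_comb_blocks s w a n i : blocks s w -> (i < n)%N ->
  crop (fun m => s i <= m < s i.+1)%N (comb a w n) = a i *: w i.
Proof.
move=> [si sw] lin; apply/funext => m.
change (crop (fun m => s i <= m < s i.+1)%N (comb a w n) m = a i * w i m).
rewrite /crop; case: ifPn => im; last by rewrite sw// mulr0.
rewrite combE (@sum_single _ (fun j => a j * w j m) i) ?lin// => j ji.
rewrite sw ?mulr0//; have [i0 Hi0] := increasing_blocks_unique m si.
by apply/negP => /Hi0 ji0; move/eqP: ji; apply; rewrite ji0; exact/esym/Hi0.
Qed.

Lemma schreier_card_le F m n : schreier F -> m \in F -> (m < n)%N -> (#|` F| <= n)%N.
Proof. by move=> /allP sF /sF mF mn; exact: leq_trans mF mn. Qed.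

Lemma schreier_sub F (P : pred nat) :
  schreier F -> schreier [fset m in F | P m]%fset.
Proof.
move=> /allP sF; apply/allP => m; rewrite !inE/= => /andP[mF _].
apply: leq_trans (sF m mF); apply: fsubset_leq_card.
by apply/fsubsetP => t; rewrite !inE => /andP[].
Qed.

(** A Schreier set with an element below [n] has at most [n] elements; this is
how smallness of coordinates is turned into smallness of a seminorm. *)
Definition meets_below F n : bool := has (fun m => m < n)%N F.

Lemma schreier_mu_meets_below (q : R) F x n h : 1 <= q -> 0 <= h -> schreier F ->
  meets_below F n -> (forall m, n%:R * modulus (x m) <= h) ->
  schreier_mu q x F <= h.
Proof.
move=> q1 h0 sF /hasP[m mF mn] xh; have q0 : 0 < q by exact: lt_le_trans q1.
have n0 : (0 < n)%N by exact: leq_ltn_trans mn.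
have nR0 : 0 < n%:R :> R by rewrite ltr0n.
rewrite /schreier_mu powRV_le// ?sum_powR_ge0//.
apply: (@le_trans _ _ (\sum_(t <- F) h `^ q / n%:R)).
  apply: ler_sum => t _.
  apply: (@le_trans _ _ ((h / n%:R) `^ q)).
    rewrite ler_powR_cancel ?modulus_ge0 ?divr_ge0//.
    by rewrite ler_pdivlMr// mulrC.
  rewrite powRM ?invr_ge0// ler_wpM2l ?powR_ge0//.
  by apply: ge1r_powR => //; rewrite invr_gt0 nR0 invf_le1// ler1n.
rewrite big_const_seq count_predT iter_addr addr0 -[leLHS]mulr_natl.
rewrite mulrCA -[leRHS]mulr1 ler_wpM2l ?powR_ge0// ler_pdivrMr// mul1r ler_nat.
exact: schreier_card_le sF mF mn.
Qed.

(** If a set starts above [s i0] and meets the block [i0], it has elements below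
the later cuts, while the earlier blocks lie below all its elements. So there is
at most one block that the set meets without meeting anything before it. *)
Lemma blocks_not_meets_below s w F : blocks s w ->
  exists i0, forall i m, i != i0 -> ~~ meets_below F (s i) -> m \in F -> w i m = 0.
Proof.
move=> [si sw]; have sle := increasing_nondecreasing si.
have [[i0 [Fi0 [m0 [m0F /andP[_ m0i]]]]]|H] := pselect (exists i,
    ~~ meets_below F (s i) /\ exists m, m \in F /\ (s i <= m < s i.+1)%N).
  exists i0 => i m ii0 Fi mF; apply: sw; apply/negP => /andP[im mi].
  have [lt|gt|eq] := ltngtP i i0; last by rewrite eq eqxx in ii0.
    case/negP: Fi0; apply/hasP; exists m => //.
    by apply: leq_trans mi _; exact: sle.
  case/negP: Fi; apply/hasP; exists m0 => //.
  by apply: leq_trans m0i _; exact: sle.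
exists 0%N => i m _ Fi mF; apply: sw; apply/negP => im.
by apply: H; exists i; split => //; exists m.
Qed.

Lemma schreier_mu_eq0 (q : R) x F : 0 < q -> (forall m, m \in F -> x m = 0) ->
  schreier_mu q x F = 0.
Proof.
move=> q0 H; rewrite /schreier_mu big_seq big1.
  by rewrite powR0// invr_neq0// lt0r_neq0.
by move=> m /H ->; rewrite modulus0 powR0// lt0r_neq0.
Qed.

End finite_seminorms.

Section finite_space_coordinates.
Context {R : realType} {k : scalars}.
Local Notation K := (scalar_field R k).

Lemma finite_space_coordinates (N : extended_norm R k) :
  coordinates N (@coords R k N : finite_space N -> nat -> K).
Proof.
split; [exact: coordsD|exact: coordsZ|move=> x c].
by rewrite /norm_le norm_finite_spaceE le_of_real -enorm_fineK lee_fin.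
Qed.

Lemma normed_subspace_coordinates (N : extended_norm R k)
    (V : normedModType K) (A : submodClosed V) (iota : V -> nat -> K) :
  coordinates N iota ->
  coordinates N (fun x : normed_subspace A => iota (inclusion x)).
Proof.
move=> Vi; split=> [x y|a x|x c].
- by rewrite inclusionD (coordinatesD Vi).
- by rewrite inclusionZ (coordinatesZ Vi).
- by rewrite (coordinates_norm Vi) norm_inclusion.
Qed.

End finite_space_coordinates.

(** * The convexified Schreier space *)

Section schreier_space.
Context {R : realType} {k : scalars}.
Local Notation K := (scalar_field R k).
Implicit Types (x y a : nat -> K) (c d : R) (w : nat -> nat -> K)
  (F : {fset nat}).
Variables (p : R) (p1 : 1 <= p).
Local Notation N := (schreier_enorm k p1).
Local Notation D := (linfty_enorm R k).

Let p0 : 0 < p. Proof. exact: lt_le_trans p1. Qed.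

Lemma schreier_le x c :
  norm_le N x c <-> forall F, schreier F -> schreier_mu p x F <= c.
Proof.
split=> [xc F sF|H].
  by rewrite -lee_fin; apply: le_trans xc; apply: ereal_sup_ubound; exists F.
by apply: ge_ereal_sup => _ [F sF <-]; rewrite lee_fin H.
Qed.

Lemma schreier_mu_ge0 x F : 0 <= schreier_mu p x F.
Proof. exact: powR_ge0. Qed.

Lemma le_schreier_mu x y F :
  (forall n, n \in F -> modulus (x n) <= modulus (y n)) ->
  schreier_mu p x F <= schreier_mu p y F.
Proof.
move=> xy; apply: ge0_ler_powR; rewrite ?nnegrE ?invr_ge0 ?(ltW p0) ?sum_powR_ge0//.
rewrite big_seq [leRHS]big_seq; apply: ler_sum => n nF.
by rewrite ler_powR_cancel ?modulus_ge0// xy.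
Qed.

Lemma schreier_lattice x y c : (forall n, modulus (x n) <= modulus (y n)) ->
  norm_le N y c -> norm_le N x c.
Proof.
move=> xy /schreier_le yc; apply/schreier_le => F sF.
by apply: le_trans (yc F sF); apply: le_schreier_mu => n _.
Qed.

Lemma schreier_fatou x c :
  (forall m, norm_le N (crop (fun n => n < m)%N x) c) -> norm_le N x c.
Proof.
move=> H; apply/schreier_le => F sF.
apply: le_trans ((schreier_le _ _).1 (H (\max_(n <- F) n).+1) F sF).
apply: le_schreier_mu => n nF; rewrite /crop ltnS.
by rewrite (@leq_bigmax_seq _ _ _ id n).
Qed.

Lemma schreier_coord x c n : norm_le N x c -> modulus (x n) <= c.
Proof.
move=> /schreier_le/(_ _ (schreier1 n)); rewrite /schreier_mu big_seq_fset1.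
by rewrite powRK ?modulus_ge0// lt0r_neq0.
Qed.

(** The combination dominates each of its terms [a i *: w i]. *)
Lemma schreier_lower s w a n c : blocks s w -> (forall i, ~ norm_le N (w i) 1) ->
  norm_le N (comb a w n) c -> norm_le D (comb a delta n) c.
Proof.
move=> bw w1 ac; have c0 := norm_le_ge0 ac.
apply/(linfty_comb_le _ _ (@inj_id nat) c0) => i lin.
rewrite leNgt; apply/negP => ca; apply: (w1 i).
have a0 : 0 < modulus (a i) by exact: le_lt_trans ca.
have aN0 : a i != 0.
  by apply/eqP => a0'; rewrite a0' modulus0 ltxx in a0.
have aw : norm_le N (a i *: w i) c.
  rewrite -(crop_comb_blocks _ bw lin); apply: schreier_lattice ac => m.
  by rewrite /crop; case: ifP; rewrite ?modulus0 ?modulus_ge0.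
have := norm_leZ (a i)^-1 aw; rewrite scalerA mulVf// scale1r.
apply: norm_leW; rewrite -(ler_pM2l a0) mulrA -modulusM mulfV// modulus1.
by rewrite mul1r mulr1 ltW.
Qed.

Lemma schreier_mu_sum (I : Type) (r : seq I) (f : I -> nat -> K) F :
  schreier_mu p (\sum_(i <- r) f i) F <= \sum_(i <- r) schreier_mu p (f i) F.
Proof.
elim/big_rec2 : _ => [|i y z _ IH].
  by rewrite schreier_mu_eq0.
apply: le_trans (schreier_muD p1 _ _ _) _; by rewrite lerD2l.
Qed.

(** A Schreier set meets at most one block without meeting coordinates below it;
this block contributes at most [c]. On every other block the seminorm is at most
[2^-1 ^+ i.+1], so that, with coefficients bounded by [c], these blocks
contribute at most [c] altogether. *)
Lemma schreier_upper s w a n c : blocks s w -> (forall i, norm_le N (w i) 1) ->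
  (forall i m, (s i)%:R * modulus (w i m) <= 2^-1 ^+ i.+1) ->
  norm_le D (comb a delta n) c -> norm_le N (comb a w n) (2 * c).
Proof.
move=> bw w1 ws ac; have c0 := norm_le_ge0 ac.
have {}ac := (linfty_comb_le _ _ (@inj_id nat) c0).1 ac.
apply/schreier_le => F sF; apply: le_trans (schreier_mu_sum _ _ _) _.
under eq_bigr do rewrite (schreier_muZ p1).
rewrite (bigID (fun i : 'I_n => meets_below F (s i)))/= mulrDl mul1r lerD//.
  apply: (@le_trans _ _ (\sum_(i < n) c * 2^-1 ^+ i.+1)).
    rewrite big_mkcond; apply: ler_sum => i _; case: ifP => Fi; last first.
      by rewrite mulr_ge0// exprn_ge0.
    apply: ler_pM; rewrite ?modulus_ge0 ?schreier_mu_ge0 ?ac//.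
    exact: (schreier_mu_meets_below p1 (exprn_ge0 _ _) sF Fi (ws i)).
  by rewrite -mulr_sumr -[leRHS]mulr1 ler_wpM2l// sum_half_le1.
have [i0 Hi0] := blocks_not_meets_below F bw.
rewrite big_mkcond/= (@sum_single _ (fun i => if ~~ meets_below F (s i)
    then modulus (a i) * schreier_mu p (w i) F else 0) i0); last first.
  move=> i ii0; case: ifP => // Fi; rewrite schreier_mu_eq0 ?mulr0// => m.
  exact: Hi0.
case: ifP => // i0n; case: ifP => // _; rewrite -[leRHS]mulr1.
apply: ler_pM; rewrite ?modulus_ge0 ?schreier_mu_ge0 ?ac//.
exact: (schreier_le _ _).1 (w1 i0) F sF.
Qed.

Lemma schreier_sum_blocks s w n : blocks s w -> (forall i, norm_le N (w i) 1) ->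
  norm_le N (\sum_(i < n) w i) (n%:R `^ p^-1).
Proof.
move=> bw w1; apply/schreier_le => F sF; rewrite /schreier_mu.
apply: ge0_ler_powR; rewrite ?nnegrE ?invr_ge0 ?(ltW p0) ?sum_powR_ge0//.
have E m : modulus ((\sum_(i < n) w i) m) `^ p = \sum_(i < n) modulus (w i m) `^ p.
  have z0 : modulus (0 : K) `^ p = 0 by rewrite modulus0 powR0// lt0r_neq0.
  have [i0 wi0] := blocks_at m bw.
  rewrite fct_sumE (sum_single n wi0).
  rewrite (@sum_single _ (fun i => modulus (w i m) `^ p) i0).
    by case: ifP.
  by move=> i /wi0 ->.
under eq_bigr do rewrite E.
rewrite exchange_big/=; apply: (@le_trans _ _ (\sum_(i < n) 1)).
  apply: ler_sum => i _; rewrite [leRHS](_ : 1 = 1 `^ p); last by rewrite powR1.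
  rewrite -powRV_le ?sum_powR_ge0//.
  exact: (schreier_le _ _).1 (w1 i) F sF.
by rewrite sumr_const card_ord.
Qed.

Lemma schreier_space_like : schreier_like N D p.
Proof.
split.
- exact: p1.
- exact: schreier_lattice.
- exact: schreier_fatou.
- exact: schreier_coord.
- exact: schreier_lower.
- exact: schreier_upper.
- by move=> x c F sF /schreier_le; apply.
- exact: schreier_sum_blocks.
- by move=> x y c xy /linfty_le yc; apply/linfty_le => n; exact: le_trans (yc n).
- by move=> x c n /linfty_le.
- exact: linfty_spreading.
- by move=> e; exact: linfty_growth.
- exact: linfty_dyadic.
Qed.

Definition schreier_coords (x : schreier_space k p1) : nat -> K :=
  coords (inclusion x : finite_space N).

Lemma schreier_coordinates : coordinates N schreier_coords.
Proof. exact: (normed_subspace_coordinates _ (finite_space_coordinates N)). Qed.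

Lemma coords_sum_unit_vector (M : extended_norm R k) a n :
  coords (\sum_(i < n) a i *: unit_vector M i) = comb a delta n.
Proof. exact: (coordinates_comb (finite_space_coordinates M)). Qed.

(** A regular vector is approximated by its heads. Conversely a vector of the
closed span is close to a finitely supported one, which has no tail beyond its
support. *)
Lemma schreier_space_regular x :
  regular N x <-> exists v, schreier_coords v = x.
Proof.
have NC := finite_space_coordinates N.
split=> [rx|[v <-] e e0].
  have [c xc] := regular_bounded rx.
  pose y : finite_space N := FiniteSpace (norm_le_lty xc : x \in finite_enorm N).
  have yspan : y \in in_closed_span (unit_vector N : nat -> schreier_Z k p1).
    rewrite unfold_in; apply/asboolP => B /nbhs_ballP[e /= e0 yB].
    have me0 : 0 < modulus e by rewrite -(of_real_gt0 (k := k)) -gt0_of_real.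
    have [m xm] := rx _ (divr_gt0 me0 (ltr0n _ 2)).
    exists (\sum_(i < m) x i *: unit_vector N i); split; first by exists m, x.
    apply: yB; rewrite -ball_normE /=.
    apply: (@le_lt_trans _ _ (of_real k (modulus e / 2))); last first.
      rewrite [ltRHS]gt0_of_real// lt_def le_of_real; apply/andP; split; last by lra.
      by apply/eqP => /of_real_inj; lra.
    apply/(coordinates_norm NC); rewrite (coordinatesB NC) coords_sum_unit_vector.
    rewrite comb_delta /= [X in X - _](cropC (fun n => n < m)%N) addrAC subrr add0r.
    have -> // : crop (fun n => ~~ (n < m)%N) x = crop (fun n => m <= n)%N x.
    by apply/funext => n; rewrite /crop -leqNgt.
  by exists (NormedSubspace yspan).
have /asboolP cv := valP v.
have e2 : 0 < of_real k e by rewrite of_real_gt0.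
have [z [[n [a ->]] vz]] := cv _ (nbhsx_ballx (inclusion v) _ e2).
exists n.
have {}vz : norm_le N (schreier_coords v - comb a delta n) e.
  rewrite -(coords_sum_unit_vector N a n) -(coordinatesB NC).
  by apply/(coordinates_norm NC)/ltW; move: vz; rewrite -ball_normE.
apply: schreier_lattice vz => m; rewrite /crop.
case: leqP => nm; last by rewrite modulus0 modulus_ge0.
rewrite [X in _ <= modulus X](_ : _ = schreier_coords v m - comb a delta n m)//.
by rewrite comb_delta /crop ltnNge nm subr0.
Qed.

End schreier_space.
(** * The Baernstein space *)

Section baernstein_space.
Context {R : realType} {k : scalars}.
Local Notation K := (scalar_field R k).
Implicit Types (x y a : nat -> K) (c d : R) (w : nat -> nat -> K)
  (F : {fset nat}) (C : seq {fset nat}).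
Variables (p : R) (p1 : 1 < p).
Local Notation N := (baernstein_enorm k p1).
Local Notation D := (lp_enorm k (ltW p1)).

Let p0 : 0 < p. Proof. exact: lt_trans ltr01 p1. Qed.

Definition mass x F : R := \sum_(n <- F) modulus (x n).

Lemma mass_ge0 x F : 0 <= mass x F.
Proof. by apply: sumr_ge0 => n _; exact: modulus_ge0. Qed.

Lemma schreier_mu1 x F : schreier_mu 1 x F = mass x F.
Proof.
rewrite /schreier_mu invr1 powRr1 ?sum_powR_ge0//.
by apply: eq_bigr => n _; rewrite powRr1// modulus_ge0.
Qed.

(** Schreier chains with empty members and the empty chain allowed. They compute
the same norm and are stable under concatenation and restriction of the
members. *)
Definition prechain C : bool :=
  all schreier C && pairwise (fun F G : {fset nat} => allrel ltn F G) C.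

Lemma baernstein_le x c : 0 <= c ->
  norm_le N x c <->
  forall C, prechain C -> \sum_(F <- C) mass x F `^ p <= c `^ p.
Proof.
move=> c0; split=> [xc C /andP[sC pC]|H]; last first.
  apply: ge_ereal_sup => _ [C /and3P[_ sC pC] <-]; rewrite lee_fin.
  rewrite /baernstein_beta powRV_le ?sum_powR_ge0//; apply: H.
  by rewrite /prechain pC andbT; apply: sub_all sC => F /andP[].
(* Empty members contribute nothing to the sum. *)
pose C' := [seq F <- C | F != fset0].
have -> : \sum_(F <- C) mass x F `^ p = \sum_(F <- C') mass x F `^ p.
  rewrite big_filter [RHS]big_mkcond; apply: eq_bigr => F _.
  case: eqP => //= ->; rewrite /mass big_seq_fset0.
  by rewrite powR0// lt0r_neq0.
have [->|C'0] := eqVneq C' [::]; first by rewrite big_nil powR_ge0.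
rewrite -powRV_le ?sum_powR_ge0// -lee_fin; apply: le_trans xc.
apply: ereal_sup_ubound; exists C' => //; apply/and3P; split => //.
  apply/allP => F; rewrite mem_filter => /andP[-> FC] /=.
  exact: (allP sC).
exact: pairwise_filter.
Qed.

Lemma le_mass x y F : (forall n, n \in F -> modulus (x n) <= modulus (y n)) ->
  mass x F <= mass y F.
Proof.
by move=> xy; rewrite /mass big_seq [leRHS]big_seq; apply: ler_sum => n /xy.
Qed.

Lemma baernstein_lattice x y c : (forall n, modulus (x n) <= modulus (y n)) ->
  norm_le N y c -> norm_le N x c.
Proof.
move=> xy yc; have c0 := norm_le_ge0 yc.
apply/(baernstein_le _ c0) => C sC.
apply: le_trans ((baernstein_le _ c0).1 yc C sC); apply: ler_sum => F _.
by rewrite ler_powR_cancel ?mass_ge0//; apply: le_mass => n _.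
Qed.

Lemma baernstein_fatou x c :
  (forall m, norm_le N (crop (fun n => n < m)%N x) c) -> norm_le N x c.
Proof.
move=> H; have c0 := norm_le_ge0 (H 0%N); apply/(baernstein_le _ c0) => C sC.
pose m := (\max_(F <- C) \max_(n <- F) n).+1.
apply: le_trans ((baernstein_le _ c0).1 (H m) C sC).
rewrite big_seq [leRHS]big_seq; apply: ler_sum => F FC.
rewrite ler_powR_cancel ?mass_ge0//; apply: le_mass => n nF.
have -> // : crop (fun n => n < m)%N x n = x n.
rewrite /crop ltnS (@leq_trans (\max_(n <- F) n))//.
  exact: (@leq_bigmax_seq _ _ _ id n).
exact: (@leq_bigmax_seq _ _ _ (fun F : {fset nat} => \max_(n <- F) n)%N F).
Qed.

Lemma baernstein_coord x c n : norm_le N x c -> modulus (x n) <= c.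
Proof.
move=> xc; have c0 := norm_le_ge0 xc.
have := (baernstein_le _ c0).1 xc [:: [fset n]%fset].
rewrite /prechain/= schreier1 big_seq1 /mass big_seq_fset1 => /(_ isT).
by rewrite ler_powR_cancel ?modulus_ge0.
Qed.

Lemma baernstein_not_le x c : 0 <= c -> ~ norm_le N x c ->
  exists2 C, prechain C & c `^ p < \sum_(F <- C) mass x F `^ p.
Proof.
move=> c0 xc; apply: contrapT => H; apply: xc; apply/(baernstein_le _ c0) => C sC.
by rewrite leNgt; apply/negP => cC; apply: H; exists C.
Qed.

Lemma mass_crop x F (P : pred nat) :
  mass x [fset n in F | P n]%fset = mass (crop P x) F.
Proof.
rewrite /mass (perm_big [seq n <- F | P n])/=; last first.
  apply: uniq_perm; rewrite ?fset_uniq ?filter_uniq ?fset_uniq// => n.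
  by rewrite !inE mem_filter andbC.
rewrite big_filter big_mkcond/=; apply: eq_bigr => n _; rewrite /crop.
by case: (P n) => //; rewrite modulus0.
Qed.

Lemma massZ (z : K) x F : mass (z *: x) F = modulus z * mass x F.
Proof. by rewrite /mass mulr_sumr; apply: eq_bigr => n _; rewrite modulusM. Qed.

(** Chains that are nearly norming for the blocks can be cut to the supports of
the blocks and concatenated into one chain, along which the p-th powers add
up. *)
Lemma baernstein_lower s w a n c : blocks s w -> (forall i, ~ norm_le N (w i) 1) ->
  norm_le N (comb a w n) c -> norm_le D (comb a delta n) c.
Proof.
move=> bw w1 xc; have c0 := norm_le_ge0 xc; have [si sw] := bw.
apply/(lp_comb_le _ _ _ (@inj_id nat) c0).
pose x := comb a w n.
have [C [sC _ aC]] : exists C, [/\ prechain C,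
    forall F m, F \in C -> m \in F -> (m < s n)%N &
    \sum_(i < n) modulus (a i) `^ p <= \sum_(F <- C) mass x F `^ p]; last first.
  exact: le_trans aC ((baernstein_le _ c0).1 xc C sC).
suff : forall t, (t <= n)%N -> exists C, [/\ prechain C,
    forall F m, F \in C -> m \in F -> (m < s t)%N &
    \sum_(i < t) modulus (a i) `^ p <= \sum_(F <- C) mass x F `^ p].
  by apply.
elim=> [|t IH] tn; first by exists [::]; rewrite big_ord0 big_nil.
have [C [/andP[sC pC] Cs aC]] := IH (ltnW tn).
have [C' /andP[sC' pC'] wC'] := baernstein_not_le ler01 (w1 t).
pose P m := (s t <= m < s t.+1)%N.
pose C1 := [seq [fset m in (F : {fset nat}) | P m]%fset | F <- C'].
have C1P F m : F \in C1 -> m \in F -> P m.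
  by move=> /mapP[G _ ->]; rewrite !inE => /andP[].
exists (C ++ C1); split.
- apply/andP; split.
    rewrite all_cat sC/=; apply/allP => F /mapP[G GC' ->].
    by apply: schreier_sub; exact: (allP sC').
  rewrite pairwise_cat pC/=; apply/andP; split.
    apply/allrelP => F G FC GC1; apply/allrelP => m m' mF m'G.
    have /andP[sm' _] := C1P _ _ GC1 m'G.
    exact: leq_trans (Cs F m FC mF) sm'.
  rewrite pairwise_map; apply: sub_pairwise pC' => F G /allrelP FG.
  apply/allrelP => m m'; rewrite !inE => /andP[mF _] /andP[m'G _].
  exact: FG.
- move=> F m; rewrite mem_cat => /orP[FC|FC1] mF.
    exact: leq_trans (Cs F m FC mF) (ltnW (si _ _ (ltnSn t))).
  by have /andP[] := C1P _ _ FC1 mF.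
- rewrite big_ord_recr/= big_cat/= lerD// big_map.
  rewrite (eq_bigr (fun F => modulus (a t) `^ p * mass (w t) F `^ p)); last first.
    move=> F _; rewrite mass_crop /x (crop_comb_blocks _ bw tn) massZ.
    by rewrite powRM ?modulus_ge0 ?mass_ge0.
  rewrite -mulr_sumr -[leLHS]mulr1 ler_wpM2l ?powR_ge0//.
  by move: wC'; rewrite powR1 => /ltW.
Qed.

Lemma mass_comb_le a w n F :
  mass (comb a w n) F <= \sum_(i < n) modulus (a i) * mass (w i) F.
Proof.
under eq_bigr do rewrite -schreier_mu1 -(schreier_muZ (lexx 1)).
by rewrite -schreier_mu1; exact: schreier_mu_sum.
Qed.

(** At most one member of a chain meets both the coordinates below [s] and the
support of [x]: the members following one that reaches [s] lie beyond [s]. *)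
Lemma sum_meets_below C x s t h : 0 <= h -> prechain C ->
  (forall m, ~~ (s <= m < t)%N -> x m = 0) ->
  (forall m, s%:R * modulus (x m) <= h) ->
  \sum_(F <- C) (if meets_below F s then mass x F else 0) <= h.
Proof.
move=> h0 sC x0 xh; elim: C sC => [|F C IH]; first by rewrite big_nil.
rewrite /prechain/= => /andP[/andP[sF sC] /andP[FC pC]]; rewrite big_cons.
have {}IH := IH (introT andP (conj sC pC)).
have [/hasP[m mF sm]|/hasPn Fs] := boolP (has (fun m => s <= m)%N F); last first.
  have -> : mass x F = 0.
    rewrite /mass big_seq big1// => m mF; rewrite x0 ?modulus0//.
    by rewrite (negbTE (Fs m mF)).
  by case: ifP; rewrite add0r.
rewrite [X in _ + X]big_seq big1 ?addr0.
  case: ifP => // Fs; rewrite -schreier_mu1.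
  exact: (schreier_mu_meets_below _ h0 sF Fs).
move=> G GC; case: ifP => // /hasP[m' m'G m's].
have /allrelP/(_ _ _ mF m'G) := allP FC _ GC.
by move=> /= mm'; have := ltn_trans mm' m's; rewrite ltnNge sm.
Qed.

Lemma sum_powR_le_powR_sum (I : Type) (r : seq I) (b : I -> R) :
  (forall i, 0 <= b i) -> \sum_(i <- r) b i `^ p <= (\sum_(i <- r) b i) `^ p.
Proof.
move=> b0; have S0 r' : 0 <= \sum_(i <- r') b i by exact: sumr_ge0.
have pm1 : 0 <= p - 1 by rewrite subr_ge0 ltW.
elim: r => [|i r IH]; first by rewrite !big_nil powR0// lt0r_neq0.
rewrite !big_cons; apply: le_trans (lerD (lexx _) IH) _.
have T0 : 0 <= b i + \sum_(i <- r) b i by rewrite addr_ge0.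
have E (t : R) : 0 <= t -> t `^ p = t * t `^ (p - 1) by move=> t0; rewrite mulr_powRB1.
rewrite (E (b i))// (E (\sum_(j <- r) b j))// (E (b i + _))// [leRHS]mulrDl.
apply: lerD; rewrite ler_wpM2l//;
  by apply: ge0_ler_powR; rewrite ?nnegrE// ?lerDl ?lerDr.
Qed.

(** For a member [F] of a chain, [A F] collects the only block that [F] meets
without meeting coordinates below it, and [B F] the remaining ones. For [A],
the p-th powers add up as for disjoint blocks. For [B], summing first over the
members of the chain leaves at most [2^-1 ^+ i.+1] for the block [i]. *)
Lemma baernstein_upper s w a n c : blocks s w -> (forall i, norm_le N (w i) 1) ->
  (forall i m, (s i)%:R * modulus (w i m) <= 2^-1 ^+ i.+1) ->
  norm_le D (comb a delta n) c -> norm_le N (comb a w n) (2 * c).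
Proof.
move=> bw w1 ws ac; have c0 := norm_le_ge0 ac; have [si sw] := bw.
have aic i : (i < n)%N -> modulus (a i) <= c.
  move=> lin; have := lp_coord i ac; rewrite comb_delta /crop lin.
  exact.
have {}ac := (lp_comb_le _ _ _ (@inj_id nat) c0).1 ac.
have cc0 : 0 <= 2 * c by rewrite mulr_ge0.
apply/(baernstein_le _ cc0) => C sC.
pose t (F : {fset nat}) i := modulus (a i) * mass (w i) F.
have t0 F i : 0 <= t F i by rewrite mulr_ge0 ?modulus_ge0 ?mass_ge0.
pose A F := \sum_(i < n) (if meets_below F (s i) then 0 else t F i).
pose B F := \sum_(i < n) (if meets_below F (s i) then t F i else 0).
have A0 F : 0 <= A F by apply: sumr_ge0 => i _; case: ifP.
have B0 F : 0 <= B F by apply: sumr_ge0 => i _; case: ifP.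
have xAB F : mass (comb a w n) F <= A F + B F.
  apply: le_trans (mass_comb_le _ _ _ _) _; rewrite -big_split/=.
  by apply: ler_sum => i _; case: ifP; rewrite ?addr0 ?add0r.
rewrite -powRV_le ?sum_powR_ge0//.
apply: le_trans (le_minkowski_seq C (ltW p1) A0 B0 (mass_ge0 _) xAB) _.
rewrite mulrDl mul1r; apply: lerD; rewrite powRV_le ?sum_powR_ge0//; last first.
  apply: le_trans (sum_powR_le_powR_sum _ B0) _.
  rewrite ler_powR_cancel ?sumr_ge0// exchange_big/=.
  apply: (@le_trans _ _ (\sum_(i < n) c * 2^-1 ^+ i.+1)); last first.
    by rewrite -mulr_sumr -[leRHS]mulr1 ler_wpM2l// sum_half_le1.
  apply: ler_sum => i _.
  rewrite (eq_bigr (fun F => modulus (a i) *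
      (if meets_below F (s i) then mass (w i) F else 0))); last first.
    by move=> F _; case: ifP; rewrite ?mulr0.
  rewrite -mulr_sumr; apply: ler_pM; rewrite ?modulus_ge0 ?aic//.
    by apply: sumr_ge0 => F _; case: ifP; rewrite ?mass_ge0.
  exact: (sum_meets_below (exprn_ge0 _ _) sC (sw i) (ws i)).
apply: le_trans ac.
have z0 : 0 `^ p = 0 :> R by rewrite powR0// lt0r_neq0.
apply: (@le_trans _ _ (\sum_(F <- C) \sum_(i < n) t F i `^ p)).
  apply: ler_sum => F _; have [i0 Hi0] := blocks_not_meets_below F bw.
  rewrite /A (@sum_single _ (fun i => if meets_below F (s i) then 0 else t F i) i0).
    case: ifP => i0n; last by rewrite z0 sum_powR_ge0.
    case: ifP => _; first by rewrite z0 sum_powR_ge0.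
    by rewrite (bigD1 (Ordinal i0n))//= lerDl sumr_ge0// => i _; exact: powR_ge0.
  move=> i ii0; case: ifPn => // Fi; rewrite /t /mass big_seq big1 ?mulr0// => m mF.
  by rewrite (Hi0 i m)// modulus0.
rewrite exchange_big/=; apply: ler_sum => i _.
rewrite (eq_bigr (fun F => modulus (a i) `^ p * mass (w i) F `^ p)); last first.
  by move=> F _; rewrite /t powRM ?modulus_ge0 ?mass_ge0.
rewrite -mulr_sumr -[leRHS]mulr1 ler_wpM2l ?powR_ge0//.
by have := (baernstein_le _ ler01).1 (w1 i) C sC; rewrite powR1.
Qed.

Lemma baernstein_space_like : schreier_like N D 1.
Proof.
split.
- by [].
- exact: baernstein_lattice.
- exact: baernstein_fatou.
- exact: baernstein_coord.
- exact: baernstein_lower.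
- exact: baernstein_upper.
- move=> x c F sF xc; have c0 := norm_le_ge0 xc; rewrite schreier_mu1.
  have := (baernstein_le _ c0).1 xc [:: F]; rewrite /prechain/= sF big_seq1.
  by move=> /(_ isT); rewrite ler_powR_cancel ?mass_ge0.
- move=> s w n _ w1; rewrite invr1 powRr1//.
  have -> : n%:R = \sum_(i < n) 1 :> R by rewrite sumr_const card_ord.
  by apply: norm_le_sum => i _ _.
- exact: lp_lattice.
- exact: lp_coord.
- exact: lp_spreading.
- by move=> e; exact: lp_growth.
- exact: lp_dyadic.
Qed.

(** If the tails stayed above [e], the Fatou property would cut [x] into
infinitely many blocks of norm larger than [e], and [baernstein_lower] would force the
norm of [x] to exceed [e] times the p-th root of any integer. *)
Lemma baernstein_finite_regular x c : norm_le N x c -> regular N x.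
Proof.
move=> xc e e0; have c0 := norm_le_ge0 xc.
apply: contrapT => nreg.
have [|f [s [_ si fP]]] := @gliding_choice (fun _ s _ s' => ~ norm_le N (slice s s' x) e).
  move=> _ s l0; exists l0.
  have xs : ~ norm_le N (crop (fun n => s <= n)%N x) e.
    by move=> xs; apply: nreg; exists s.
  have [t tx] : exists t, ~ norm_le N (crop (fun n => n < t)%N
      (crop (fun n => s <= n)%N x)) e.
    apply: contrapT => H; apply: xs; apply: baernstein_fatou => t.
    by apply: contrapT => xt; apply: H; exists t.
  exists (maxn s.+1 t); split; [exact: leqnn|exact: leq_maxl|move=> xt].
  apply: tx; apply: baernstein_lattice xt => n.
  rewrite crop_comp /slice /crop leq_max; case: (ltnP n t) => nt /=.
    by rewrite orbT andbT.
  by rewrite modulus0 modulus_ge0.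
pose w i := of_real k e^-1 *: slice (s i) (s i.+1) x.
have bw : blocks s w.
  exact: (blocksZ (fun=> of_real k e^-1) (blocks_slice (fun=> x) si)).
have w1 i : ~ norm_le N (w i) 1.
  move=> /(norm_leZr (ltW e0)); rewrite mulr1 scalerA -of_realM mulfV ?lt0r_neq0//.
  by rewrite of_real1 scale1r; exact: fP.
have xw n : norm_le N (comb (fun=> of_real k e) w n) c.
  apply: baernstein_lattice xc => m; rewrite combE.
  have [i0 wi0] := blocks_at m bw.
  rewrite (@sum_single _ (fun i => of_real k e * w i m) i0).
    case: ifP => _; last by rewrite modulus0 modulus_ge0.
    rewrite [X in _ * X](_ : _ = of_real k e^-1 * slice (s i0) (s i0.+1) x m)//.
    rewrite mulrA -of_realM mulfV ?lt0r_neq0// of_real1 mul1r /slice /crop.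
    by case: ifP; rewrite ?modulus0 ?modulus_ge0.
  by move=> i /wi0 ->; rewrite mulr0.
have bound n : n%:R * e `^ p <= c `^ p.
  have := baernstein_lower bw w1 (xw n).
  move=> /(lp_comb_le _ _ _ (@inj_id nat) c0); apply: le_trans.
  by rewrite sumr_const card_ord modulus_of_real ger0_norm ?(ltW e0)// mulr_natl.
have ep : 0 < e `^ p by rewrite powR_gt0.
have := bound (Num.truncn (c `^ p / e `^ p)).+1.
by rewrite -ler_pdivlMr// leNgt truncnS_gt.
Qed.

Lemma baernstein_space_regular x : regular N x <->
  exists v : baernstein_space k p1, coords (v : finite_space N) = x.
Proof.
split=> [rx|[v <-]].
  have [c xc] := regular_bounded rx.
  by exists (FiniteSpace (norm_le_lty xc : x \in finite_enorm N)).
have [c vc] := norm_le_ex (valP v); exact: baernstein_finite_regular vc.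
Qed.

End baernstein_space.

Theorem proposition4p3 (R : realType) (k : scalars) :
  (forall (p : R) (p1 : 1 < p) (x : nat -> baernstein_space k p1),
     basic_sequence x ->
     (subsymmetric x <-> equivalent x (lp_unit_vector k (ltW p1))))
  /\
  (forall (p : R) (p1 : 1 <= p) (x : nat -> schreier_space k p1),
     basic_sequence x ->
     (subsymmetric x <-> equivalent x (c0_unit_vector R k))).
Proof.
split=> p p1 x bx.
  exact: (subsymmetric_equivalent (baernstein_space_like p1)
    (finite_space_coordinates _) (baernstein_space_regular p1)
    (finite_space_coordinates _) _ bx).
apply: (subsymmetric_equivalent (schreier_space_like p1)
  (schreier_coordinates p1) (schreier_space_regular p1)
  (normed_subspace_coordinates _ (finite_space_coordinates (linfty_enorm R k))) _ bx).
by [].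
Qed.
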